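(* Let $\eta\in(1,\infty)$. Put $R_{\mathbb{Z}}=\{0\}\cup\{\eta^{-n}\mid n\in\mathbb{Z}\}$ and $R_{\mathbb{Q}}=\{0\}\cup\{\eta^{-g}\mid g\in\mathbb{Q}\}$. Equip each valued field $(K,v)$ below with the ultrametric $(x,y)\mapsto\eta^{-v(x-y)}$ (with $\eta^{-\infty}=0$). Then: (1) For every prime $p$, the completion $\widehat{\mathbb{Q}_p^{\mathrm{unr}}}$ of the maximal unramified extension of $\mathbb{Q}_p$, with the valuation extending $v_p$, is isometric to $(\mathbb{V}_{R_{\mathbb{Z}}},\sigma_{R_{\mathbb{Z}}})$. (2) For every prime $p$, the field $\mathbb{C}_p$ of $p$-adic complex numbers, with the valuation extending $v_p$, is isometric to $(\mathbb{V}_{R_{\mathbb{Q}}},\sigma_{R_{\mathbb{Q}}})$. (3) For every countably infinite field $k$, the Laurent series field $k((t))$ with the $t$-adic valuation $v_t$ is isometric to $(\mathbb{V}_{R_{\mathbb{Z}}},\sigma_{R_{\mathbb{Z}}})$. (4) For every countably infinite field $k$, and for a fixed extension of $v_t$ to an algebraic closure $\overline{k((t))}$ of $k((t))$, the completion $\widehat{\overline{k((t))}}$ (with the extended valuation, again denoted $v_t$) is isometric to $(\mathbb{V}_{R_{\mathbb{Q}}},\sigma_{R_{\mathbb{Q}}})$.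
   Context: Here $v_p$ is the $p$-adic valuation normalized by $v_p(p)=1$, and $v_t$ is normalized by $v_t(t)=1$; $\mathbb{C}_p$ is the completion of an algebraic closure of $\mathbb{Q}_p$. Metric spaces are nonempty. For a countable set $R\subseteq[0,\infty)$ with $0\in R$, a metric space is $R$-valued if all its distances lie in $R$. Let $\mathscr{N}(R)$ be the class of finite $R$-valued ultrametric spaces. A metric space $X$ is $\mathscr{N}(R)$-injective if for all $A,B\in\mathscr{N}(R)$ and isometric embeddings $\phi\colon A\to B$, $\psi\colon A\to X$ there is an isometric embedding $\theta\colon B\to X$ with $\theta\circ\phi=\psi$. The $R$-Urysohn universal ultrametric space $(\mathbb{V}_R,\sigma_R)$ is the separable complete $R$-valued $\mathscr{N}(R)$-injective ultrametric space, which is unique up to isometry. *)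

(* Defs.v *)
From HB Require Import structures.
From mathcomp Require Import all_boot all_order all_algebra all_field.
From mathcomp Require Import ring lra zify.
From mathcomp Require Import all_classical all_reals all_analysis.

Set Implicit Arguments.
Unset Strict Implicit.
Unset Printing Implicit Defensive.
Import Order.TTheory GRing.Theory Num.Theory.
Local Open Scope classical_set_scope.
Local Open Scope ring_scope.

Section LaurentSeries.
Variable k : fieldType.
Implicit Types f g h : int -> k.

Definition bounded_below f := exists a : int, forall n : int, n < a -> f n = 0.

Record laurent := Laurent {
  lcoef :> int -> k ;
  lcoef_bounded : `[< bounded_below lcoef >] }.

HB.instance Definition _ := [isSub for lcoef].
HB.instance Definition _ := [Choice of laurent by <:].

Lemma laurentP (x y : laurent) : lcoef x =1 lcoef y -> x = y.
Proof. by move=> xy; apply: val_inj; apply/funext. Qed.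

Let below f (a : int) := forall n : int, n < a -> f n = 0.

(* Cauchy product; the sum is finitely supported when f and g are bounded
   below. *)
Definition conv f g : int -> k := fun n => \sum_(i \in setT) f i * g (n - i).

Definition lone : int -> k := fun n => (n == 0)%:R.

Let P (a : int) m f : {poly k} := \poly_(i < m) f (a + i%:Z).

Lemma conv_below f g a b : below f a -> below g b -> below (conv f g) (a + b).
Proof.
move=> fa gb n nab; apply: fsbig1 => i _.
have [ia|ai] := ltP i a; first by rewrite fa ?mul0r.
by rewrite (gb (n - i)) ?mulr0// ltrBlDr (lt_le_trans nab)// addrC lerD2l.
Qed.

Lemma convE f g a b n : below f a -> below g b ->
  conv f g (a + b + n%:Z) = \sum_(i < n.+1) f (a + i%:Z) * g (b + (n - i)%N%:Z).
Proof.
move=> fa gb; pose F i := f i * g (a + b + n%:Z - i).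
pose s : int -> Prop := [set a + i%:Z | i in `I_n.+1].
rewrite /conv -(fsbig_widen s setT F)//; last first.
  move=> i [_] /= nsi; rewrite /F.
  have [ia|ai] := ltP i a; first by rewrite fa ?mul0r.
  have [gi|ig] := ltP (a + b + n%:Z - i) b; first by rewrite (gb _ gi) mulr0.
  exfalso; apply: nsi; exists `|i - a|%N => /=.
    by lia.
  by lia.
rewrite /s fsbig_image; last by move=> i j _ _ /addrI [].
rewrite -(fsbig_ord _ _ (fun i => F (a + i%:Z))); apply: eq_bigr => i _.
rewrite /F; congr (_ * g _).
have := ltn_ord i; rewrite ltnS => ilen.
by rewrite -subzn//; ring.
Qed.


Lemma conv_coef f g a b m n : (n < m)%N -> below f a -> below g b ->
  conv f g (a + b + n%:Z) = (P a m f * P b m g)`_n.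
Proof.
move=> nm fa gb; rewrite convE// coefM; apply: eq_bigr => i _.
by rewrite !coef_poly !ifT//; have := ltn_ord i; lia.
Qed.

Lemma below_conv f g : bounded_below f -> bounded_below g ->
  bounded_below (conv f g).
Proof. by move=> [a fa] [b gb]; exists (a + b); apply: conv_below. Qed.

Lemma below_lone : bounded_below lone.
Proof. by exists 0 => n n0; rewrite /lone lt_eqF. Qed.

Lemma convC f g : bounded_below f -> bounded_below g -> conv f g = conv g f.
Proof.
move=> [a fa] [b gb]; apply/funext => n.
have [nab|abn] := ltP n (a + b).
  by rewrite (conv_below fa gb)// (conv_below gb fa)// addrC.
have -> : n = a + b + `|(n - (a + b))%R|%N%:Z by lia.
set m := `|_|%N; rewrite (conv_coef (ltnSn m) fa gb) mulrC (addrC a b).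
by rewrite (conv_coef (ltnSn m) gb fa).
Qed.

Lemma convA f g h : bounded_below f -> bounded_below g -> bounded_below h ->
  conv f (conv g h) = conv (conv f g) h.
Proof.
move=> [a fa] [b gb] [c hc]; apply/funext => n.
have gh := conv_below gb hc; have fg := conv_below fa gb.
have [nab|abn] := ltP n (a + b + c).
  by rewrite (conv_below fg hc)// (conv_below fa gh)// addrA.
have -> : n = a + b + c + `|(n - (a + b + c))%R|%N%:Z by lia.
set m := `|_|%N; rewrite (conv_coef (ltnSn m) fg hc).
rewrite -(addrA a b c) (conv_coef (ltnSn m) fa gh).
have -> : (P (a + b) m.+1 (conv f g) * P c m.+1 h)`_m =
    (P a m.+1 f * P b m.+1 g * P c m.+1 h)`_m.
  rewrite [LHS]coefM [RHS]coefM; apply: eq_bigr => i _; congr (_ * _).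
  by rewrite coef_poly ltn_ord (conv_coef (ltn_ord i)).
rewrite -mulrA [LHS]coefM [RHS]coefM; apply: eq_bigr => i _; congr (_ * _).
have im : (m - i < m.+1)%N by lia.
by rewrite coef_poly im (conv_coef im).
Qed.

Lemma conv1 f : bounded_below f -> conv lone f = f.
Proof.
move=> [a fa]; apply/funext => n.
rewrite /conv -(fsbig_widen [set 0]) ?fsbig_set1//; last first.
  by move=> i [_ /= /eqP i0]; rewrite /lone (negbTE i0) mul0r.
by rewrite /lone eqxx mul1r subr0.
Qed.

Lemma convDl f g h : bounded_below f -> bounded_below g -> bounded_below h ->
  conv (f + g) h = conv f h + conv g h.
Proof.
move=> [a' fa] [a'' ga] [c hc].
pose a := Num.min a' a''.
have {}fa : below f a by move=> n; rewrite lt_min => /andP[+ _]; exact: fa.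
have {}ga : below g a by move=> n; rewrite lt_min => /andP[_ +]; exact: ga.
have fga : below (f + g) a.
  by move=> n na; rewrite [LHS](_ : _ = f n + g n)// fa// ga// addr0.
apply/funext => n; rewrite [RHS](_ : _ = conv f h n + conv g h n)//.
have [nab|abn] := ltP n (a + c).
  by rewrite (conv_below fga hc)// (conv_below fa hc)// (conv_below ga hc)// addr0.
have -> : n = a + c + `|(n - (a + c))%R|%N%:Z by lia.
rewrite !convE// -big_split; apply: eq_bigr => i _ /=.
by rewrite -mulrDl.
Qed.

Lemma lone_neq0 : lone != 0.
Proof.
apply/eqP => /(congr1 (@^~ 0)) /eqP.
by rewrite /lone eqxx; apply/negP; exact: oner_neq0.
Qed.

Lemma zmod_closed_bounded_below : zmod_closed (fun f => `[< bounded_below f >]).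
Proof.
split; first by apply/asboolP; exists 0.
move=> f g /asboolP[a fa] /asboolP[b gb]; apply/asboolP; exists (Num.min a b).
move=> n; rewrite lt_min => /andP[na nb].
by rewrite [LHS](_ : _ = f n - g n)// fa// gb// subr0.
Qed.

HB.instance Definition _ := GRing.SubChoice_isSubZmodule.Build (int -> k) _
  laurent zmod_closed_bounded_below.

Lemma lcoef_below (x : laurent) : bounded_below x.
Proof. exact/asboolP/lcoef_bounded. Qed.

Definition lmul (x y : laurent) : laurent :=
  Laurent (asboolT (below_conv (lcoef_below x) (lcoef_below y))).

Lemma lmulA : associative lmul.
Proof.
move=> x y z; apply: val_inj.
exact: convA (lcoef_below x) (lcoef_below y) (lcoef_below z).
Qed.

Lemma lmulC : commutative lmul.
Proof.
by move=> x y; apply: val_inj; exact: convC (lcoef_below x) (lcoef_below y).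
Qed.

Lemma lmul1 : left_id (Laurent (asboolT below_lone)) lmul.
Proof. by move=> x; apply: val_inj; exact: conv1 (lcoef_below x). Qed.

Lemma lmulDl : left_distributive lmul +%R.
Proof.
move=> x y z; apply: val_inj.
exact: convDl (lcoef_below x) (lcoef_below y) (lcoef_below z).
Qed.

Lemma lone_laurent_neq0 : Laurent (asboolT below_lone) != 0.
Proof. by apply/eqP => /(congr1 val) /eqP; apply/negP; exact: lone_neq0. Qed.

HB.instance Definition _ := GRing.Zmodule_isComNzRing.Build laurent
  lmulA lmulC lmul1 lmulDl lone_laurent_neq0.

Lemma laurentDE (x y : laurent) n : (x + y) n = x n + y n. Proof. by []. Qed.

Lemma laurentME (x y : laurent) n :
  (x * y) n = \sum_(i \in setT) x i * y (n - i).
Proof. by []. Qed.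

Lemma laurent_order (x : laurent) : x != 0 ->
  exists2 a : int, x a != 0 & forall n : int, n < a -> x n = 0.
Proof.
move=> x0; have [a xa] := lcoef_below x.
have : exists m : nat, x (a + m%:Z) != 0.
  apply: contrapT => /forallNP x00; move/eqP: x0; apply; apply: laurentP => n.
  rewrite [RHS](_ : _ = 0)//; have [/xa//|an] := ltP n a.
  have := x00 `|(n - a)%R|%N; rewrite (_ : a + _ = n); last by lia.
  by move/negP/negPn/eqP.
case/ex_minnP => m xm mmin; exists (a + m%:Z) => // n nam.
have [/xa//|an] := ltP n a.
have := mmin `|(n - a)%R|%N; rewrite (_ : a + _%:Z = n); last by lia.
by case: eqP => // _ /(_ isT); lia.
Qed.

Section Inverse.
Variables (f : int -> k) (a : int).

Fixpoint inv_seq (n : nat) : seq k :=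
  if n is m.+1 then
    rcons (inv_seq m)
      (((m == 0%N)%:R - \sum_(i < m) (inv_seq m)`_i * f (a + (m - i)%N%:Z)) / f a)
  else [::].

Let c n := (inv_seq n.+1)`_n.

Let size_inv_seq n : size (inv_seq n) = n.
Proof. by elim: n => //= n IHn; rewrite size_rcons IHn. Qed.

Let nth_inv_seq n i : (i < n)%N -> (inv_seq n)`_i = c i.
Proof.
elim: n => // n IHn; rewrite ltnS leq_eqVlt => /predU1P[->//|iltn].
by rewrite [LHS]/= nth_rcons size_inv_seq iltn IHn.
Qed.

Definition inv_coef (n : int) : k := if n < - a then 0 else c `|(n + a)%R|%N.

Lemma conv_inv : f a != 0 -> below f a -> conv inv_coef f = lone.
Proof.
move=> fa0 fa.
have ga : below inv_coef (- a) by move=> n na; rewrite /inv_coef na.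
apply/funext => n; have [n0|n0] := ltP n 0.
  by rewrite (conv_below ga fa) ?addNr// /lone lt_eqF.
have -> : n = - a + a + `|n|%N%:Z by lia.
rewrite convE//; set m := `|n|%N.
have gE i : inv_coef (- a + i%:Z) = c i.
  by rewrite /inv_coef ifF; [congr (c _); lia | apply/negbTE; rewrite -leNgt; lia].
under eq_bigr do rewrite gE.
rewrite big_ord_recr/= subnn addr0 /c/= nth_rcons size_inv_seq ltnn eqxx.
rewrite divfK//.
under [X in _ - X]eq_bigr do rewrite nth_inv_seq//.
by rewrite addrC subrK /lone addNr add0r.
Qed.

End Inverse.

Lemma laurent_inv_ex (x : laurent) :
  exists y, if x == 0 then y = 0 else y * x = 1.
Proof.
case: eqVneq => [x0|x0]; first by exists 0.
have [a xa0 xa] := laurent_order x0.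
have gb : bounded_below (inv_coef x a).
  by exists (- a) => n na; rewrite /inv_coef na.
exists (Laurent (asboolT gb)); apply: val_inj.
exact: conv_inv.
Qed.

Definition linv (x : laurent) : laurent := projT1 (cid (laurent_inv_ex x)).

Lemma lmulV (x : laurent) : x != 0 -> linv x * x = 1.
Proof. by move=> x0; rewrite /linv; case: cid => y /=; rewrite (negbTE x0). Qed.

Lemma linv0 : linv 0 = 0.
Proof. by rewrite /linv; case: cid => y /=; rewrite eqxx. Qed.

HB.instance Definition _ := GRing.ComNzRing_isField.Build laurent lmulV linv0.

End LaurentSeries.

Section ValuedFields.
Variable R : realType.

Definition is_valuation (K : fieldType) (v : K -> \bar R) : Prop :=
  [/\ forall x, v x = +oo%E <-> x = 0,
      forall x, v x <> -oo%E,
      forall x y, v (x * y) = (v x + v y)%E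
    & forall x y, (mine (v x) (v y) <= v (x + y)%R)%E].

Record valuedField := ValuedField {
  vfield :> fieldType ;
  vval : vfield -> \bar R ;
  vvalP : is_valuation vval }.

End ValuedFields.
Arguments vval {R v} x : rename.

Section ValuedFieldTheory.
Variables (R : realType) (K : valuedField R).
Implicit Types x y : K.

Lemma vval0 : vval (0 : K) = +oo%E.
Proof. by have [h _ _ _] := vvalP K; apply/h. Qed.

Lemma vval_fin x : x != 0 -> vval x \is a fin_num.
Proof.
have [h1 h2 _ _] := vvalP K => /eqP x0.
by rewrite fin_numE; apply/andP; split; apply/eqP => // /h1.
Qed.

Lemma vvalM x y : vval (x * y) = (vval x + vval y)%E.
Proof. by have [_ _ h _] := vvalP K; apply: h. Qed.

Lemma vvalD x y : (mine (vval x) (vval y) <= vval (x + y)%R)%E.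
Proof. by have [_ _ _ h] := vvalP K; apply: h. Qed.

Lemma vval1 : vval (1 : K) = 0%E.
Proof.
have := vvalM 1 1; rewrite mulr1; have := vval_fin (oner_neq0 K).
by case: vval => // r _ [] /eqP; rewrite -subr_eq0 opprD addNKr oppr_eq0 => /eqP ->.
Qed.

Lemma vvalN x : vval (- x) = vval x.
Proof.
suff v1 : vval (- 1 : K) = 0%E by rewrite -mulN1r vvalM v1 add0e.
have := vvalM (- 1) (- 1); rewrite mulrNN mulr1 vval1.
have : (- 1 : K) != 0 by rewrite oppr_eq0 oner_eq0.
move/vval_fin; case: vval => // r _ [] /esym/eqP.
by rewrite -mulr2n mulrn_eq0/= => /eqP ->.
Qed.

End ValuedFieldTheory.

(* K with the distance (x, y) |-> eta^(- v (x - y)), where eta^(- oo) = 0.  The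
   topology does not depend on the choice of eta > 1. *)
Definition eta_space (R : realType) (eta : R) (eta1 : 1 < eta)
  (K : valuedField R) : Type := K.

Section EtaSpace.
Variables (R : realType) (eta : R) (eta1 : 1 < eta) (K : valuedField R).

Definition eta_dist (x y : K) : R :=
  if vval (x - y) is r%:E then eta `^ (- r) else 0.

Let eta0 : 0 < eta. Proof. exact: lt_trans eta1. Qed.

Let eta_dist_ge0 (x y : K) : 0 <= eta_dist x y.
Proof. by rewrite /eta_dist; case: vval => // r; exact: powR_ge0. Qed.

Lemma eta_distxx (x : K) : eta_dist x x = 0.
Proof. by rewrite /eta_dist subrr vval0. Qed.

Lemma eta_dist_eq0 (x y : K) : eta_dist x y = 0 -> x = y.
Proof.
move=> xy; apply/eqP; rewrite -subr_eq0; apply/negP => /negP/vval_fin.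
move: xy; rewrite /eta_dist; case: vval => // r /eqP; rewrite gt_eqF//.
exact: powR_gt0.
Qed.

Lemma eta_dist_sym (x y : K) : eta_dist x y = eta_dist y x.
Proof. by rewrite /eta_dist -opprB vvalN. Qed.

Lemma eta_dist_ultra (y x z : K) :
  eta_dist x z <= Num.max (eta_dist x y) (eta_dist y z).
Proof.
have [<-|xy] := eqVneq x y; first by rewrite eta_distxx le_max lexx orbT.
have [<-|yz] := eqVneq y z; first by rewrite le_max lexx.
have := vvalD (x - y) (y - z); rewrite addrA subrK.
rewrite -subr_eq0 in xy; rewrite -subr_eq0 in yz.
move: (vval_fin xy) (vval_fin yz); rewrite /eta_dist.
case: (vval (x - y)) => // r _; case: (vval (y - z)) => // s _.
case: (vval (x - z)) => [t| |]; last 2 first.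
- by rewrite le_max powR_ge0.
- by rewrite leNgt ltNye; have [] := leP r%:E s%:E.
have mono u w : u <= w -> eta `^ (- w) <= eta `^ (- u).
  by move=> uw; rewrite ler_powR ?lerN2// ltW.
rewrite ge_min !lee_fin => /orP[] /mono h; rewrite le_max h ?orbT//.
Qed.

Lemma eta_dist_triangle (y x z : K) :
  eta_dist x z <= eta_dist x y + eta_dist y z.
Proof.
apply: le_trans (eta_dist_ultra y x z) _.
by rewrite ge_max lerDl lerDr !eta_dist_ge0.
Qed.

HB.instance Definition _ := Choice.on (eta_space eta1 K).
HB.instance Definition _ := isMetric.Build R (eta_space eta1 K)
  eta_distxx eta_dist_eq0 eta_dist_sym eta_dist_triangle.

Lemma eta_spaceE (x y : eta_space eta1 K) : mdist x y = eta_dist x y.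
Proof. by []. Qed.

End EtaSpace.

Section PadicValuation.
Variables (R : realType) (p : nat).

Definition padic_val (x : rat) : \bar R :=
  if x == 0 then +oo%E
  else ((logn p `|numq x|)%:R - (logn p `|denq x|)%:R)%:E.

Hypothesis p_prime : prime p.

Let padic_val_frac (a b : int) : a != 0 -> b != 0 ->
  padic_val (a%:~R / b%:~R) = ((logn p `|a|)%:R - (logn p `|b|)%:R)%:E.
Proof.
move=> a0 b0; rewrite /padic_val; set x := _ / _.
have x0 : x != 0 by rewrite mulf_neq0 ?invr_eq0 ?intr_eq0.
rewrite (negbTE x0); congr _%:E; apply/eqP.
rewrite subr_eq addrAC eq_sym subr_eq -!natrD eqr_nat.
rewrite -!lognM ?absz_gt0 ?denq_neq0 ?numq_eq0// -!abszM.
suff -> : a * denq x = numq x * b by [].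
apply: (@intr_inj rat); rewrite !intrM.
have := divq_num_den x; rewrite {3}/x => /eqP.
by rewrite eqr_div ?intr_eq0 ?denq_neq0// => /eqP ->.
Qed.

Let frac (x : rat) : x != 0 -> exists a b : int,
  [/\ a != 0, b != 0 & x = a%:~R / b%:~R].
Proof.
move=> x0; exists (numq x), (denq x).
by rewrite numq_eq0 denq_neq0 divq_num_den.
Qed.

Let padic_valM x y : padic_val (x * y) = (padic_val x + padic_val y)%E.
Proof.
have [->|x0] := eqVneq x 0.
  by rewrite mul0r /padic_val eqxx; case: ifP.
have [->|y0] := eqVneq y 0.
  by rewrite mulr0 /padic_val eqxx; case: ifP.
have [a [b [a0 b0 ->]]] := frac x0; have [c [d [c0 d0 ->]]] := frac y0.
rewrite mulf_div -!intrM !padic_val_frac ?mulf_neq0// !abszM.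
by rewrite !lognM ?absz_gt0// !natrD -EFinD; congr _%:E; ring.
Qed.

Let logn_int (a b : int) (m : nat) : a + b != 0 ->
  (p ^ m %| `|a|)%N -> (p ^ m %| `|b|)%N -> (m <= logn p `|(a + b)%R|)%N.
Proof.
move=> ab0 ma mb; rewrite -pfactor_dvdn ?absz_gt0//.
have -> : (p ^ m %| `|(a + b)%R|)%N = (((p ^ m)%N : int) %| a + b)%Z by [].
by rewrite rpredD.
Qed.

Let padic_valD x y :
  (mine (padic_val x) (padic_val y) <= padic_val (x + y)%R)%E.
Proof.
have [->|x0] := eqVneq x 0; first by rewrite add0r ge_min lexx orbT.
have [->|y0] := eqVneq y 0; first by rewrite addr0 ge_min lexx.
have [xy0|xy0] := eqVneq (x + y) 0.
  by rewrite {3}/padic_val xy0 eqxx leey.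
move: xy0; have [a [b [a0 b0 ->]]] := frac x0.
have [c [d [c0 d0 ->]]] := frac y0.
rewrite addf_div ?intr_eq0// -!intrM -intrD => xy0.
have n0 : a * d + c * b != 0.
  by apply: contraNneq xy0 => ->; rewrite mul0r.
rewrite !padic_val_frac ?mulf_neq0// !abszM !lognM ?absz_gt0// natrD.
have ad : (p ^ (logn p `|a| + logn p `|d|) %| `|(a * d)%R|)%N.
  by rewrite expnD abszM dvdn_mul// pfactor_dvdnn.
have cb : (p ^ (logn p `|c| + logn p `|b|) %| `|(c * b)%R|)%N.
  by rewrite expnD abszM dvdn_mul// pfactor_dvdnn.
have [le|le] := leqP (logn p `|a| + logn p `|d|) (logn p `|c| + logn p `|b|).
- have := logn_int n0 ad (dvdn_trans (dvdn_exp2l p le) cb).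
  rewrite -(ler_nat R) natrD => h.
  by rewrite ge_min lee_fin; apply/orP; left; lra.
- have := logn_int n0 (dvdn_trans (dvdn_exp2l p (ltnW le)) ad) cb.
  rewrite -(ler_nat R) natrD => h.
  by rewrite ge_min !lee_fin; apply/orP; right; lra.
Qed.

Lemma padic_valuation : is_valuation padic_val.
Proof.
split; [|by move=> x; rewrite /padic_val; case: ifP|exact: padic_valM|
  exact: padic_valD].
by move=> x; rewrite /padic_val; split=> [|->]; [case: eqP|rewrite eqxx].
Qed.

Definition rat_padic : valuedField R := ValuedField padic_valuation.

End PadicValuation.

Section TadicValuation.
Variables (R : realType) (k : fieldType).
Implicit Types x y : laurent k.

(* ereal_inf set0 = +oo, so that v_t(0) = +oo *)
Definition tadic_val x : \bar R :=
  ereal_inf [set n%:~R%:E | n in [set n : int | x n != 0]].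

Lemma tadic_val_order x (a : int) :
  x a != 0 -> (forall n : int, n < a -> x n = 0) -> tadic_val x = a%:~R%:E.
Proof.
move=> xa0 xa; apply/eqP; rewrite eq_le; apply/andP; split.
  by apply: ereal_inf_lbound; exists a.
apply: le_ereal_inf_tmp => _ [n /= xn <-]; rewrite lee_fin ler_int leNgt.
by apply: contra xn => /xa ->.
Qed.

Let tadic_val0 : tadic_val 0 = +oo%E.
Proof.
rewrite /tadic_val (_ : [set n | _] = set0) ?image_set0 ?ereal_inf0//.
by apply/seteqP; split => n //=; rewrite [_ n](_ : _ = 0)// eqxx.
Qed.

Let tadic_valM x y : tadic_val (x * y) = (tadic_val x + tadic_val y)%E.
Proof.
have [->|/laurent_order[a xa0 xa]] := eqVneq x 0.
  rewrite mul0r tadic_val0; have [->|/laurent_order[b yb0 yb]] := eqVneq y 0.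
    by rewrite tadic_val0.
  by rewrite (tadic_val_order yb0 yb).
have [->|/laurent_order[b yb0 yb]] := eqVneq y 0.
  by rewrite mulr0 tadic_val0 (tadic_val_order xa0 xa).
rewrite (tadic_val_order xa0 xa) (tadic_val_order yb0 yb) -EFinD -intrD.
apply: tadic_val_order; last exact: conv_below.
have := convE 0 xa yb; rewrite big_ord1 /= !addr0 => xyab.
by rewrite [X in X != 0]xyab mulf_neq0.
Qed.

Let tadic_valD x y :
  (mine (tadic_val x) (tadic_val y) <= tadic_val (x + y)%R)%E.
Proof.
apply: le_ereal_inf_tmp => _ [n /= xyn <-]; rewrite ge_min.
have [xn|xn] := eqVneq (x n) 0; last first.
  by apply/orP; left; apply: ereal_inf_lbound; exists n.
apply/orP; right; apply: ereal_inf_lbound; exists n => //=.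
by have : x n + y n != 0 := xyn; rewrite xn add0r.
Qed.

Lemma tadic_valuation : is_valuation tadic_val.
Proof.
split; [|move=> x|exact: tadic_valM|exact: tadic_valD].
  move=> x; split=> [|->//].
  have [->//|/laurent_order[a xa0 xa]] := eqVneq x 0.
  by rewrite (tadic_val_order xa0 xa).
have [->|/laurent_order[a xa0 xa]] := eqVneq x 0; first by rewrite tadic_val0.
by rewrite (tadic_val_order xa0 xa).
Qed.

Definition laurent_tadic : valuedField R := ValuedField tadic_valuation.

End TadicValuation.

Section Extensions.
Variable R : realType.

Definition extends_val (F L : valuedField R) (j : F -> L) : Prop :=
  forall x, vval (j x) = vval x.

Definition complete_space (X : metricType R) : Prop :=
  forall F : set_system X, ProperFilter F -> cauchy F -> exists l : X, F --> l.

Definition is_completion (eta : R) (eta1 : 1 < eta) (F K : valuedField R)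
    (i : {rmorphism F -> K}) : Prop :=
  [/\ extends_val i,
      complete_space (eta_space eta1 K)
    & dense (range i : set (eta_space eta1 K))].

Definition is_algebraic_closure (F L : fieldType) (j : {rmorphism F -> L}) :
  Prop := GRing.closed_field_axiom L /\ forall x : L, algebraicOver j x.

Section Unramified.
Variables (Qp L : valuedField R) (j : {rmorphism Qp -> L}).

(* A finite extension E of Q_p inside L is unramified if its ramification index
   is 1, i.e. if E and Q_p have the same value group. The residue field F_p of
   Q_p being perfect, nothing has to be required of the residue extension. *)
Definition unramified (E : fieldExtType Qp) (f : {rmorphism E -> L}) : Prop :=
  [set vval (f x) | x in [set x : E | x != 0]] =
  [set vval y | y in [set y : Qp | y != 0]].

Definition max_unramified : set L := [set x : L |
  exists (E : fieldExtType Qp) (f : {rmorphism E -> L}),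
    [/\ forall a : Qp, f a%:A = j a, unramified f & range f x]].

End Unramified.

Section PadicFields.
Variables (eta : R) (eta1 : 1 < eta) (p : nat) (p_prime : prime p).

Definition is_Qp (Qp : valuedField R) : Prop :=
  exists i : {rmorphism rat -> Qp},
    @is_completion eta eta1 (rat_padic R p_prime) Qp i.

Definition is_Qp_bar (Qp L : valuedField R) (j : {rmorphism Qp -> L}) : Prop :=
  [/\ is_Qp Qp, is_algebraic_closure j & extends_val j].

(* U is Q_p^unr, with the restriction of the valuation of an algebraic closure *)
Definition is_Qp_unr (U : valuedField R) : Prop :=
  exists (Qp L : valuedField R) (j : {rmorphism Qp -> L})
         (u : {rmorphism U -> L}),
    [/\ is_Qp_bar j, extends_val u & range u = max_unramified j].

Definition is_Qp_unr_hat (K : valuedField R) : Prop :=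
  exists (U : valuedField R) (c : {rmorphism U -> K}),
    is_Qp_unr U /\ is_completion eta1 c.

Definition is_Cp (K : valuedField R) : Prop :=
  exists (Qp L : valuedField R) (j : {rmorphism Qp -> L})
         (c : {rmorphism L -> K}),
    is_Qp_bar j /\ is_completion eta1 c.

End PadicFields.
End Extensions.

Section Urysohn.
Variable R : realType.
Implicit Types X Y A B V : metricType R.

Definition ultrametric X : Prop :=
  forall x y z : X, mdist x z <= Num.max (mdist x y) (mdist y z).

Definition valued_in (S : set R) X : Prop := forall x y : X, S (mdist x y).

Definition separable_space X : Prop :=
  exists2 D : set X, countable D & dense D.

Definition isometric_embedding X Y (f : X -> Y) : Prop :=
  forall x y, mdist (f x) (f y) = mdist x y.

Definition isometric X Y : Prop :=
  exists f : X -> Y, isometric_embedding f /\ range f = setT.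

Definition finite_ultrametric (S : set R) A : Prop :=
  [/\ [set: A] !=set0, finite_set [set: A], valued_in S A & ultrametric A].

Definition injective_for (S : set R) X : Prop :=
  forall A B (phi : A -> B) (psi : A -> X),
    finite_ultrametric S A -> finite_ultrametric S B ->
    isometric_embedding phi -> isometric_embedding psi ->
    exists theta : B -> X, isometric_embedding theta /\ theta \o phi = psi.

Definition is_urysohn (S : set R) V : Prop :=
  [/\ [set: V] !=set0, ultrametric V & valued_in S V] /\
  [/\ separable_space V, complete_space V & injective_for S V].

(* "X is isometric to the S-Urysohn universal ultrametric space": such a space
   exists, and X is isometric to any such space. *)
Definition isometric_to_urysohn (S : set R) X : Prop :=
  (exists V, is_urysohn S V) /\ (forall V, is_urysohn S V -> isometric X V).

Definition R_int (eta : R) : set R :=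
  [set x | x = 0 \/ exists n : int, x = eta `^ (- n%:~R)].

Definition R_rat (eta : R) : set R :=
  [set x | x = 0 \/ exists g : rat, x = eta `^ (- ratr g)].

End Urysohn.

(* Main.v *)
Require Import Defs.
From HB Require Import structures.
From mathcomp Require Import all_boot all_order all_algebra all_field.
From mathcomp Require Import ring lra zify.
From mathcomp Require Import all_classical all_reals all_analysis.
Set Implicit Arguments.
Unset Strict Implicit.
Unset Printing Implicit Defensive.
Import Order.TTheory GRing.Theory Num.Theory.
Import metricType_numDomainType.
Local Open Scope classical_set_scope.
Local Open Scope ring_scope.

(* Back and forth shows that separable complete S-injective ultrametric spaces are
   unique up to isometry, so it suffices to check that each field is one.  In a
   valued field, one-point extensions reduce by translation and scaling to
   finding an integral element whose residue avoids finitely many given residue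
   classes: a complete separable field is S-Urysohn as soon as its value group is
   S without 0 and its residue field is infinite.  Both conditions pass to
   completions.

   For an algebraically closed field the residue field is infinite because a root
   y of prod (X - z) + 1 is at distance 1 from every z, and over a discretely
   valued base the value group is the divisible hull.  For the maximal unramified
   extension of Q_p one takes an irreducible polynomial of large degree over F_p,
   lifts it to Z[X] and adjoins a root a: the powers of a below that degree are
   orthogonal over Q_p, so Q_p(a) is unramified and these powers have pairwise
   distance 1. *)

(** * Separability and completeness of metric spaces *)

Section MetricSpaces.
Variable R : realType.
Implicit Types X Y V W : metricType R.

Lemma denseP X (D : set X) :
  dense D <-> forall x e, 0 < e -> exists2 d, D d & mdist x d < e.
Proof.
split=> [Dd x e e0|Dd O [x Ox] Oo].
  have [] := Dd (interior (ball x e)).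
  - by exists x; apply: nbhsx_ballx.
  - exact: open_interior.
  move=> d [/interior_subset + Dd']; rewrite ballEmdist => xd.
  by exists d.
have /nbhs_ballP[e e0 xO] : nbhs x O by exact: open_nbhs_nbhs.
have [d Dd' xd] := Dd x e e0.
by exists d; split => //; apply: xO; rewrite ballEmdist.
Qed.

Lemma separable_isometric_dense X Y (f : X -> Y) : isometric_embedding f ->
  dense (range f) -> separable_space X -> separable_space Y.
Proof.
move=> fi /denseP fd [D Dc /denseP Dd]; exists (f @` D).
  exact: card_le_trans (card_image_le _ _) Dc.
apply/denseP => y e e0.
have e20 : 0 < e / 2 by rewrite divr_gt0.
have [_ [x _ <-] yx] := fd y _ e20.
have [d Dd' xd] := Dd x _ e20.
exists (f d); first by exists d.
by rewrite (le_lt_trans (metric_triangle _ (f x) _))// fi [e]splitr ltrD.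
Qed.

(** A dense set of [Y] may miss the image of [f], so for each dense point [d] and each [n] a point
    of [X] is chosen whose image is closer to [d] than 1/(n+1), whenever there is one. *)
Lemma separable_isometric_sub X Y (f : X -> Y) : isometric_embedding f ->
  separable_space Y -> separable_space X.
Proof.
move=> fi [D Dc /denseP Dd].
pose near_pt (dn : Y * nat) :=
  [set x : X | D dn.1 /\ mdist (f x) dn.1 < dn.2.+1%:R^-1].
pose g dn := if pselect (near_pt dn !=set0) is left h
             then [set projT1 (cid h)] else set0.
exists (\bigcup_(dn in D `*` setT) g dn).
  apply: bigcup_countable; first exact: countableX.
  move=> dn _; rewrite /g; case: pselect => // h; exact: countable1.
apply/denseP => x e e0.
have [n _ /(_ _ (leqnn _)) ne] :=
  near_infty_natSinv_lt (PosNum (divr_gt0 e0 (ltr0Sn R 1))).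
have n0 : 0 < n.+1%:R^-1 :> R by rewrite invr_gt0 ltr0Sn.
have [d Dd' xd] := Dd (f x) _ n0.
have h : near_pt (d, n) !=set0 by exists x.
exists (projT1 (cid h)).
  exists (d, n) => //; rewrite /g; case: pselect => // h'.
  by rewrite (Prop_irrelevance h h').
case: cid => y /= [_ yd]; rewrite -fi (le_lt_trans (metric_triangle _ d _))//.
rewrite [mdist d _]metric_sym [e]splitr ltrD//; exact: lt_trans ne.
Qed.

(** The sets [P e] are a base of a Cauchy filter; shrinking families can thus replace filters in the
    back-and-forth limit. *)
Lemma complete_family X (P : R -> set X) : complete_space X ->
  (forall e, 0 < e -> P e !=set0) ->
  (forall e e', e <= e' -> P e `<=` P e') ->
  (forall e x y, 0 < e -> P e x -> P e y -> mdist x y < e + e) ->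
  exists l, forall e, 0 < e -> exists2 x, P e x & mdist x l < e.
Proof.
move=> Xc P0 Pm Pd; pose F := filter_from [set e : R | 0 < e] P.
have FF : ProperFilter F.
  apply: filter_from_proper => //; apply: filter_from_filter.
    by exists 1 => /=.
  move=> a b /= a0 b0; exists (Num.min a b); first by rewrite /= lt_min a0.
  by move=> x Px; split; apply: Pm Px; rewrite ge_min lexx ?orbT.
have [l Fl] : exists l : X, F --> l.
  apply: Xc => //; apply/cauchy_ballP => e e0.
  have e20 : 0 < e / 2 by rewrite divr_gt0.
  exists (P (e / 2), P (e / 2)).
    by split; exists (e / 2).
  move=> [x y] /= [Px Py]; rewrite ballEmdist /=.
  by rewrite [e]splitr; apply: Pd Px Py.
exists l => e e0; move/fcvgrPdist_lt: Fl => /(_ e e0)[a /= a0 Pa].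
(* The minimum puts [x] both in [P e] and in [P a], all of whose points are [e]-close to [l]. *)
have [x Px] := P0 (Num.min a e) ltac:(by rewrite lt_min a0).
exists x; first by apply: Pm Px; rewrite ge_min lexx orbT.
by rewrite metric_sym; apply: Pa; apply: Pm Px; rewrite ge_min lexx.
Qed.

End MetricSpaces.

(** * One-point extensions and back and forth *)

Section MetricSub.
Variables (R : realType) (X : metricType R) (D : set X).

(** Injectivity quantifies over metric types, so finite subsets have to become types; boolean
    membership makes [val] injective. *)
Definition metric_sub : Type := {x : X | x \in D}.

HB.instance Definition _ := Choice.on metric_sub.

Definition msub_dist (x y : metric_sub) : R := mdist (val x) (val y).

Let msub_distxx x : msub_dist x x = 0. Proof. exact: mdistxx. Qed.
Let msub_dist_eq0 x y : msub_dist x y = 0 -> x = y.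
Proof. by move=> /mdist_positivity /val_inj. Qed.
Let msub_dist_sym x y : msub_dist x y = msub_dist y x.
Proof. exact: metric_sym. Qed.
Let msub_dist_triangle y x z : msub_dist x z <= msub_dist x y + msub_dist y z.
Proof. exact: metric_triangle. Qed.

HB.instance Definition _ := isMetric.Build R metric_sub
  msub_distxx msub_dist_eq0 msub_dist_sym msub_dist_triangle.

Lemma msubE (x y : metric_sub) : mdist x y = mdist (val x) (val y).
Proof. by []. Qed.

Lemma finite_ultrametric_sub (S : set R) : D !=set0 -> finite_set D ->
  ultrametric X -> valued_in S X -> finite_ultrametric S metric_sub.
Proof.
move=> [x Dx] Df Xu XS; split.
- by exists (exist _ x (mem_set Dx)).
- by rewrite (eq_finite_set (card_setT D)).
- by move=> a b; rewrite msubE; apply: XS.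
- by move=> a b c; rewrite !msubE; apply: Xu.
Qed.

End MetricSub.

Section PartialIsometries.
Variable R : realType.
Implicit Types X Y V W : metricType R.

(** A relation suffices: preserving zero distances makes it the graph of an injective map. *)
Definition partial_isometry V W (s : set (V * W)) :=
  forall a b, s a -> s b -> mdist a.1 b.1 = mdist a.2 b.2.

Definition extendable V W := forall (s : seq (V * W)) v,
  partial_isometry [set` s] -> s != [::] ->
  exists w, partial_isometry [set` (v, w) :: s].

Definition flip V W (s : seq (V * W)) : seq (W * V) :=
  [seq (a.2, a.1) | a <- s].

Lemma partial_isometry_flip V W (s : seq (V * W)) :
  partial_isometry [set` s] -> partial_isometry [set` flip s].
Proof.
move=> si a b /=; rewrite /flip => /mapP[a' sa ->] /mapP[b' sb ->] /=.
by rewrite (si _ _ sa sb).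
Qed.

Lemma flipK V W : cancel (@flip V W) (@flip W V).
Proof. by elim=> // -[a b] s /= ->. Qed.

Lemma partial_isometry_cons V W (s : seq (V * W)) v w :
  partial_isometry [set` s] -> (forall a, a \in s -> mdist v a.1 = mdist w a.2) ->
  partial_isometry [set` (v, w) :: s].
Proof.
move=> si vw a b /=; rewrite !inE.
move=> /predU1P[->|sa] /predU1P[->|sb] /=; rewrite ?mdistxx//.
- exact: vw.
- by rewrite metric_sym vw// metric_sym.
- exact: si.
Qed.

Lemma ultra_isosceles X : ultrametric X -> forall x y z : X,
  mdist x y < mdist y z -> mdist x z = mdist y z.
Proof.
move=> Xu x y z h; apply/eqP; rewrite eq_le; apply/andP; split.
  by have := Xu x y z; rewrite le_max => /orP[/le_trans->//|//]; exact: ltW.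
have := Xu y x z; rewrite le_max [mdist y x]metric_sym => /orP[|//].
by move/(lt_le_trans h); rewrite ltxx.
Qed.

(* The new point is placed at the right distance from the point of the domain
   nearest to it; the other distances are then forced. *)
Lemma extendable_of_spread (S : set R) B X :
  ultrametric B -> valued_in S B -> ultrametric X ->
  (forall (x : X) m (l : seq X), S m -> 0 < m ->
    exists2 y, mdist x y = m & forall z, z \in l -> m <= mdist y z) ->
  extendable B X.
Proof.
move=> Bu BS Xu spread s b si s0.
have [/mapP[a sa ->]|bs] := boolP (b \in map fst s).
  exists a.2; apply: partial_isometry_cons => // c sc; exact: si.
case: s s0 si bs => // a0 s _ si bs.
have [a sa amin] : exists2 a, a \in a0 :: s &
    forall c, c \in a0 :: s -> mdist b a.1 <= mdist b c.1.
  elim: (s) a0 {si bs} => [|c t IH] a0.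
    by exists a0; [exact: mem_head | move=> c; rewrite inE => /eqP ->].
  have [a ta amin] := IH c.
  have [h|/ltW h] := leP (mdist b a0.1) (mdist b a.1).
    exists a0; first exact: mem_head.
    by move=> d; rewrite inE => /predU1P[->//|/amin]; exact: le_trans.
  exists a; first by rewrite inE ta orbT.
  by move=> d; rewrite inE => /predU1P[->//|/amin].
have m0 : 0 < mdist b a.1.
  by rewrite mdist_gt0; apply: contra bs => /eqP ->; exact: map_f.
have [y xy yl] := spread a.2 _ (map snd (a0 :: s)) (BS b a.1) m0.
exists y; apply: partial_isometry_cons => // c sc.
have acE := si _ _ sa sc.
(* If [c] is as near to [b] as [a] is, the ultrametric inequality through [a] gives the upper bound
   and [spread] the lower one. *)
have := amin _ sc; rewrite le_eqVlt => /orP[/eqP bc|bc].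
  rewrite -bc; apply/eqP; rewrite eq_le yl ?map_f//= -xy.
  have := Xu y a.2 c.2; rewrite le_max (metric_sym y a.2).
  move=> /orP[//|/le_trans]; apply.
  rewrite xy -acE; have := Bu a.1 b c.1.
  by rewrite (metric_sym _ b) -bc maxxx.
(* If [c] is farther than [a], isosceles triangles reduce both distances to the one between [a] and
   [c]. *)
have -> : mdist b c.1 = mdist a.1 c.1.
  by symmetry; apply: ultra_isosceles => //; rewrite metric_sym.
rewrite acE; symmetry; apply: ultra_isosceles => //.
rewrite metric_sym xy -acE.
rewrite (_ : mdist a.1 c.1 = mdist b c.1)//.
by apply: ultra_isosceles => //; rewrite metric_sym.
Qed.

Lemma extend_seq V W (l : seq V) (s : seq (V * W)) : extendable V W ->
  partial_isometry [set` s] -> s != [::] ->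
  exists t : seq (V * W), [/\ partial_isometry [set` t], {subset s <= t}
    & {subset l <= map fst t}].
Proof.
move=> ext si s0; elim: l => [|v l [t [ti st lt]]].
  by exists s; split.
have [|w wt] := ext t v ti.
  apply: contra_neq s0 => t0; case: s st {si} => // a s /(_ a (mem_head _ _)).
  by rewrite t0.
exists ((v, w) :: t); split=> //.
  by move=> a /st; rewrite inE => ->; rewrite orbT.
by move=> u; rewrite !inE => /predU1P[->|/lt ->]; rewrite ?eqxx ?orbT.
Qed.

(** The points of [B] are added one at a time to the finite relation that pairs [phi a] with
    [psi a]. *)
Lemma injective_of_extendable (S : set R) X :
  (forall B, finite_ultrametric S B -> extendable B X) -> injective_for S X.
Proof.
move=> ext A B phi psi [[a0 _] /finite_seqP[la Ala] _ _] Bf phii psii.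
have [_ /finite_seqP[lb Blb] _ _] := Bf.
have inA a : a \in la by have : [set: A] a by []; rewrite Ala.
have inB b : b \in lb by have : [set: B] b by []; rewrite Blb.
pose s := [seq (phi a, psi a) | a <- la].
have si : partial_isometry [set` s].
  by move=> x y /= /mapP[a _ ->] /mapP[b _ ->] /=; rewrite phii psii.
have s0 : s != [::] by rewrite /s; case: (la) (inA a0).
have [t [ti st lt]] := extend_seq lb (ext _ Bf) si s0.
have /choice[theta thetaP] b : exists x, (b, x) \in t.
  by have /mapP[[c x] tcx ->] := lt b (inB b); exists x.
exists theta; split=> [x y|].
  by rewrite -(ti _ _ (thetaP x) (thetaP y)).
apply/funext => a /=; apply: mdist_positivity.
have ta : (phi a, psi a) \in t by apply: st; apply: map_f.
by rewrite -(ti _ _ (thetaP (phi a)) ta) /= mdistxx.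
Qed.

(** Injectivity is applied to the inclusion of the domain of [s] into that domain with [v] added. *)
Lemma extendable_urysohn (S : set R) V W : is_urysohn S V -> is_urysohn S W ->
  extendable V W.
Proof.
move=> [[_ Vu VS] _] [_ [_ _ Winj]] s v si s0.
pose D := [set` map fst s]; pose E := [set` v :: map fst s].
have D0 : D !=set0.
  by case: (s) s0 @D => // a t _; exists a.1; rewrite /= inE eqxx.
have DE x : D x -> E x by rewrite /D /E /= inE => ->; rewrite orbT.
have Af : finite_ultrametric S (metric_sub D).
  by apply: finite_ultrametric_sub => //; exact: finite_seq.
have Bf : finite_ultrametric S (metric_sub E).
  apply: finite_ultrametric_sub => //; last exact: finite_seq.
  by case: D0 => x /DE; exists x.
pose phi (x : metric_sub D) : metric_sub E :=
  exist _ (val x) (mem_set (DE _ (set_mem (valP x)))).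
have /choice[psi psiP] (x : metric_sub D) : exists w, (val x, w) \in s.
  by have /set_mem /mapP[[c w] scw ->] := valP x; exists w.
have [||theta [thetai thetaE]] := Winj _ _ phi psi Af Bf.
- by move=> x y; rewrite !msubE.
- by move=> x y; rewrite -(si _ _ (psiP x) (psiP y)).
have Ev : v \in E by rewrite inE /E /= inE eqxx.
exists (theta (exist _ v Ev)); apply: partial_isometry_cons => // a sa.
have Da : a.1 \in D by rewrite inE; apply: map_f.
have -> : a.2 = theta (phi (exist _ a.1 Da)).
  have := congr1 (fun f => f (exist _ a.1 Da)) thetaE => /= ->.
  apply: mdist_positivity.
  by rewrite -(si _ _ sa (psiP (exist _ a.1 Da))) /= mdistxx.
by rewrite thetai msubE.
Qed.

End PartialIsometries.

(** * Uniqueness of the Urysohn space up to isometry *)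

Section Uniqueness.
Variable R : realType.
Implicit Types X V W : metricType R.

Lemma dense_sequence X : [set: X] !=set0 -> separable_space X ->
  exists d : nat -> X, forall x e, 0 < e -> exists n, mdist x (d n) < e.
Proof.
move=> [x0 _] [D /countable_injP[f fi] /denseP Dd].
(* [f] numbers the points of the dense set; indices that number nothing are sent to [x0]. *)
have /choice[d dP] n : exists y, forall u, D u -> f u = n -> y = u.
  have [[u [Du <-]]|h] := pselect (exists u, D u /\ f u = n).
    by exists u => u' Du' /esym; apply: fi; rewrite inE.
  by exists x0 => u Du un; case: h; exists u.
exists d => x e e0; have [y Dy xy] := Dd x e e0.
by exists (f y); rewrite (dP _ y).
Qed.

(** Membership of the pair of [v] and [w] in the closure of [G] in the product. *)
Definition graph_limit V W (G : set (V * W)) v w := forall e, 0 < e ->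
  exists a, [/\ G a, mdist v a.1 < e & mdist a.2 w < e].

(** The partners of points near [v] are close to one another because [G] preserves distances, so
    they converge. *)
Lemma graph_limit_total V W (G : set (V * W)) : partial_isometry G ->
  complete_space W ->
  (forall v e, 0 < e -> exists2 a, G a & mdist v a.1 < e) ->
  forall v, exists w, graph_limit G v w.
Proof.
move=> Gi Wc Gd v.
pose P e := [set w | exists2 a, G a & mdist v a.1 < e /\ a.2 = w].
have [|||w wP] := @complete_family _ W P Wc.
- by move=> e /(Gd v)[a Ga va]; exists a.2, a.
- move=> e e' ee' w [a Ga [va aw]]; exists a => //.
  by split=> //; exact: lt_le_trans ee'.
- move=> e _ _ e0 [a Ga [va <-]] [b Gb [vb <-]].
  rewrite -(Gi _ _ Ga Gb) (le_lt_trans (metric_triangle _ v _))//.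
  by rewrite metric_sym ltrD.
by exists w => e /wP[_ [a Ga [va <-]] aw]; exists a.
Qed.

Lemma graph_limit_isometry V W (G : set (V * W)) v w v' w' :
  partial_isometry G -> graph_limit G v w -> graph_limit G v' w' ->
  mdist v v' = mdist w w'.
Proof.
move=> Gi vw vw'; apply/eqP; rewrite eq_le.
apply/andP; split; apply/ler_addgt0Pr => e e0.
(* Four approximations enter, each with an error below [e / 4]. *)
- have e40 : 0 < e / 4 by rewrite divr_gt0.
  have [a [Ga va aw]] := vw _ e40; have [b [Gb vb bw]] := vw' _ e40.
  have := metric_triangle v a.1 v'; have := metric_triangle a.1 b.1 v'.
  have := metric_triangle a.2 w b.2; have := metric_triangle w w' b.2.
  rewrite (Gi _ _ Ga Gb) (metric_sym b.1) (metric_sym w' b.2); lra.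
- have e40 : 0 < e / 4 by rewrite divr_gt0.
  have [a [Ga va aw]] := vw _ e40; have [b [Gb vb bw]] := vw' _ e40.
  have := metric_triangle w a.2 w'; have := metric_triangle a.2 b.2 w'.
  have := metric_triangle a.1 v b.1; have := metric_triangle v v' b.1.
  rewrite (Gi _ _ Ga Gb) (metric_sym a.1 v) (metric_sym w a.2); lra.
Qed.

Lemma extend_back_and_forth V W (s : seq (V * W)) v w :
  extendable V W -> extendable W V -> partial_isometry [set` s] -> s != [::] ->
  exists t : seq (V * W), [/\ partial_isometry [set` t], {subset s <= t},
    exists w', (v, w') \in t & exists v', (v', w) \in t].
Proof.
move=> VW WV si s0; have [w' w's] := VW s v si s0.
have [//|v' v's] := WV (flip ((v, w') :: s)) w (partial_isometry_flip w's).
exists ((v', w) :: (v, w') :: s); split.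
- by have := partial_isometry_flip v's; rewrite /= -/(flip _) flipK.
- by move=> a sa; rewrite !inE sa !orbT.
- by exists w'; rewrite !inE eqxx !orbT.
- by exists v'; rewrite !inE eqxx.
Qed.

(** Stage [n] puts the [n]-th points of both dense sequences into the finite partial isometry; the
    union of the stages is dense on both sides, and its closure is the graph of the isometry. *)
Lemma urysohn_unique (S : set R) V W :
  is_urysohn S V -> is_urysohn S W -> isometric V W.
Proof.
move=> VU WU; have VW := extendable_urysohn VU WU.
have WV := extendable_urysohn WU VU.
have [[V0 _ _] [Vs Vc _]] := VU; have [[W0 _ _] [Ws Wc _]] := WU.
have [dv dvP] := dense_sequence V0 Vs; have [dw dwP] := dense_sequence W0 Ws.
pose T := {s : seq (V * W) | partial_isometry [set` s] /\ s != [::]}.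
have /choice[step stepP] (ns : nat * T) : exists t : T,
    [/\ {subset sval ns.2 <= sval t}, exists w, (dv ns.1, w) \in sval t
      & exists v, (v, dw ns.1) \in sval t].
  case: ns => n [s [si s0]] /=.
  have [t [ti st tv tw]] := extend_back_and_forth (dv n) (dw n) VW WV si s0.
  have t0 : t != [::].
    apply: contra_neq s0 => t0; case: s st {si} => // a s /(_ a (mem_head _ _)).
    by rewrite t0.
  by exists (exist _ t (conj ti t0)).
have [[v0 _] [w0 _]] := (V0, W0).
have s0P : partial_isometry [set` [:: (v0, w0)]] /\ [:: (v0, w0)] != [::].
  by split => // a b /=; rewrite !inE => /eqP -> /eqP ->; rewrite !mdistxx.
pose sq := fix sq n : T :=
  if n is m.+1 then step (m, sq m) else exist _ _ s0P.
have sqS n : {subset sval (sq n) <= sval (sq n.+1)}.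
  by have [] := stepP (n, sq n).
have sq_sub m n : (m <= n)%N -> {subset sval (sq m) <= sval (sq n)}.
  move=> /subnK <-; elim: (n - m)%N => // k IH a /IH; rewrite addSn; exact: sqS.
pose G := [set a | exists n, a \in sval (sq n)].
have Gi : partial_isometry G.
  move=> a b [m am] [n bn]; have [sqi _] := svalP (sq (maxn m n)).
  apply: sqi => /=; first exact: sq_sub (leq_maxl m n) _ am.
  exact: sq_sub (leq_maxr m n) _ bn.
have Gv v e : 0 < e -> exists2 a, G a & mdist v a.1 < e.
  move=> /(dvP v)[n vn]; have [_ [w wn] _] := stepP (n, sq n).
  by exists (dv n, w) => //; exists n.+1.
have Gw w e : 0 < e -> exists2 a, G a & mdist w a.2 < e.
  move=> /(dwP w)[n wn]; have [_ _ [v vn]] := stepP (n, sq n).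
  by exists (v, dw n) => //; exists n.+1.
have /choice[f fP] := graph_limit_total Gi Wc Gv.
(* Reversing [G] yields a preimage of each point of [W]. *)
pose G' := [set a : W * V | G (a.2, a.1)].
have Gi' : partial_isometry G'.
  by move=> a b Ga Gb; have := Gi _ _ Ga Gb => /= ->.
have Gw' w e : 0 < e -> exists2 a, G' a & mdist w a.1 < e.
  by move=> /(Gw w)[[a b] Gab wb]; exists (b, a).
exists f; split=> [x y|]; first by rewrite (graph_limit_isometry Gi (fP x) (fP y)).
apply/seteqP; split => // w _.
have [v vw] := graph_limit_total Gi' Vc Gw' w; exists v => //.
apply: mdist_positivity; rewrite -(mdistxx v).
symmetry; apply: (graph_limit_isometry Gi (fP v)) => e /vw.
move=> [[b a] [/= Gab wb av]]; exists (a, b) => /=.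
by split=> //; rewrite metric_sym.
Qed.

End Uniqueness.

(** * Absolute values and the criterion for valued fields *)

Section AbsoluteValue.
Variables (R : realType) (eta : R) (eta1 : 1 < eta).

Definition vabs (K : valuedField R) (x : K) : R :=
  if vval x is r%:E then eta `^ (- r) else 0.

Let eta0 : 0 < eta. Proof. exact: lt_trans eta1. Qed.

Lemma eta_powR_inj (r s : R) : eta `^ r = eta `^ s -> r = s.
Proof.
move=> /(congr1 (@ln R)); rewrite !ln_powR => /mulIf; apply.
by rewrite gt_eqF// ln_gt0.
Qed.

Lemma eta_powRM (r s : R) : eta `^ (r + s) = eta `^ r * eta `^ s.
Proof. by rewrite powRD// (gt_eqF eta0) implybT. Qed.

Section Theory.
Variable K : valuedField R.
Implicit Types x y z : K.

Lemma mdist_eta (x y : eta_space eta1 K) : mdist x y = vabs (x - y : K).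
Proof. by []. Qed.

Lemma vabs0 : vabs (0 : K) = 0. Proof. by rewrite /vabs vval0. Qed.

Lemma vabs_fin x : x != 0 -> exists2 r, vval x = r%:E & vabs x = eta `^ (- r).
Proof. by move=> /vval_fin; rewrite /vabs; case: vval => // r _; exists r. Qed.

Lemma vabs_ge0 x : 0 <= vabs x.
Proof. by rewrite /vabs; case: vval => // r; exact: powR_ge0. Qed.

Lemma vabs_gt0 x : (0 < vabs x) = (x != 0).
Proof.
have [->|/vabs_fin[r _ ->]] := eqVneq x 0; first by rewrite vabs0 ltxx.
exact: powR_gt0.
Qed.

Lemma vabs_eq0 x : (vabs x == 0) = (x == 0).
Proof. by rewrite -[RHS]negbK -vabs_gt0 lt0r vabs_ge0 andbT negbK. Qed.

Lemma vabsM x y : vabs (x * y) = vabs x * vabs y.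
Proof.
have [->|/vabs_fin[r xr ->]] := eqVneq x 0; first by rewrite mul0r vabs0 mul0r.
have [->|/vabs_fin[s ys ->]] := eqVneq y 0; first by rewrite mulr0 vabs0 mulr0.
by rewrite /vabs vvalM xr ys -EFinD opprD eta_powRM.
Qed.

Lemma vabs1 : vabs (1 : K) = 1.
Proof. by rewrite /vabs vval1 /= oppr0 powRr0. Qed.

Lemma vabsN x : vabs (- x) = vabs x.
Proof. by rewrite /vabs vvalN. Qed.

Lemma vabsBC x y : vabs (x - y) = vabs (y - x).
Proof. by rewrite -opprB vabsN. Qed.

Lemma vabsD x y : vabs (x + y) <= Num.max (vabs x) (vabs y).
Proof.
have := @eta_dist_ultra _ _ eta1 K 0 x (- y).
by rewrite /eta_dist !opprK subr0 add0r.
Qed.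

Lemma vabsD_le x y e : vabs x <= e -> vabs y <= e -> vabs (x + y) <= e.
Proof. by move=> xe ye; rewrite (le_trans (vabsD _ _))// ge_max xe. Qed.

Lemma vabsD_lt x y e : vabs x < e -> vabs y < e -> vabs (x + y) < e.
Proof. by move=> xe ye; rewrite (le_lt_trans (vabsD _ _))// gt_max xe. Qed.

Lemma vabs_addl x y : vabs y < vabs x -> vabs (x + y) = vabs x.
Proof.
move=> yx; apply/eqP; rewrite eq_le vabsD_le ?(ltW yx)//= leNgt.
apply/negP => xyx; have : vabs (x + y - y) < vabs x by rewrite vabsD_lt ?vabsN.
by rewrite addrK ltxx.
Qed.

Lemma vabs_near x y : vabs (x - y) < vabs x -> vabs y = vabs x.
Proof.
by rewrite vabsBC => /vabs_addl; rewrite addrC subrK.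
Qed.

Lemma vabsV x : vabs x^-1 = (vabs x)^-1.
Proof.
have [->|x0] := eqVneq x 0; first by rewrite invr0 vabs0 invr0.
have vx0 : vabs x != 0 by rewrite vabs_eq0.
by apply: (mulfI vx0); rewrite -vabsM !mulfV// vabs1.
Qed.

Lemma vabsX x n : vabs (x ^+ n) = vabs x ^+ n.
Proof. by elim: n => [|n IH]; rewrite ?expr0 ?vabs1// !exprS vabsM IH. Qed.

Lemma vabs_sum_le (I : Type) (r : seq I) (P : pred I) (F : I -> K) e : 0 <= e ->
  (forall i, P i -> vabs (F i) <= e) -> vabs (\sum_(i <- r | P i) F i) <= e.
Proof.
move=> e0 Fe; elim/big_ind: _ => //; first by rewrite vabs0.
by move=> x y; exact: vabsD_le.
Qed.

Lemma vabs_sum_lt (I : Type) (r : seq I) (P : pred I) (F : I -> K) e : 0 < e ->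
  (forall i, P i -> vabs (F i) < e) -> vabs (\sum_(i <- r | P i) F i) < e.
Proof.
move=> e0 Fe; elim/big_ind: _ => //; first by rewrite vabs0.
by move=> x y; exact: vabsD_lt.
Qed.

Lemma vabs_prod (I : Type) (r : seq I) (P : pred I) (F : I -> K) :
  vabs (\prod_(i <- r | P i) F i) = \prod_(i <- r | P i) vabs (F i).
Proof. by elim/big_rec2: _ => [|i a b _ <-]; rewrite ?vabs1 ?vabsM. Qed.

Lemma vabs_natr_le1 n : vabs (n%:R : K) <= 1.
Proof.
by elim: n => [|n IH]; rewrite ?vabs0// -natr1 vabsD_le ?vabs1.
Qed.

Lemma vabs_intr_le1 (z : int) : vabs (z%:~R : K) <= 1.
Proof. by case: z => n; rewrite ?NegzE ?mulrNz ?vabsN vabs_natr_le1. Qed.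

End Theory.

(** Brings equalities of absolute values back to [vval], in which [unramified] is phrased. *)
Lemma vval_vabs (K L : valuedField R) (x : K) (y : L) :
  vabs x = vabs y -> vval x = vval y.
Proof.
have [->|x0] := eqVneq x 0.
  by rewrite vabs0 => /esym/eqP; rewrite vabs_eq0 => /eqP ->; rewrite !vval0.
have [->|y0] := eqVneq y 0.
  by rewrite vabs0 => /eqP; rewrite vabs_eq0 => /eqP ->; rewrite !vval0.
have [r -> ->] := vabs_fin x0; have [s -> ->] := vabs_fin y0.
by move=> /eta_powR_inj /oppr_inj ->.
Qed.

Lemma vabs_extends (F L : valuedField R) (j : F -> L) : extends_val j ->
  forall x, vabs (j x) = vabs x.
Proof. by move=> jv x; rewrite /vabs jv. Qed.

End AbsoluteValue.
Arguments vabs {R} eta {K} x.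

Section UrysohnFields.
Variables (R : realType) (eta : R) (eta1 : 1 < eta).
Local Notation N := (vabs eta).

(* The value group is S without 0 and the residue field is infinite: given
   finitely many residue classes, there is another one. *)
Definition urysohn_field (S : set R) (K : valuedField R) : Prop :=
  [/\ forall x : K, S (N x),
      forall m, S m -> 0 < m -> exists c : K, N c = m
    & forall l : seq K, (forall z, z \in l -> N z <= 1) ->
        exists y : K, forall z, z \in l -> N (y - z) = 1].

Lemma urysohn_field_space S (K : valuedField R) : urysohn_field S K ->
  separable_space (eta_space eta1 K) -> complete_space (eta_space eta1 K) ->
  isometric_to_urysohn S (eta_space eta1 K).
Proof.
move=> [KS KV Kres] Ks Kc.
have Ku : ultrametric (eta_space eta1 K) by move=> x y z; exact: eta_dist_ultra.
suff KU : is_urysohn S (eta_space eta1 K).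
  by split; [exists (eta_space eta1 K) | move=> V; exact: urysohn_unique].
split; split => //.
- by exists 0.
- by move=> x y; rewrite mdist_eta; exact: KS.
apply: injective_of_extendable => B [_ _ BS Bu].
apply: (extendable_of_spread (S := S)) => // x m l Sm m0.
have [c cm] := KV m Sm m0.
have c0 : c != 0 by rewrite -(vabs_gt0 eta1) cm.
(* Translation and scaling move [x] to 0 and the distance [m] to 1. Non-integral points are dropped,
   while [x] is added so that [y] becomes a unit. *)
pose l' := [seq z <- [seq (z - x : K) / c | z <- (x : K) :: l] | N z <= 1].
have [|y yP] := Kres l'; first by move=> z; rewrite mem_filter => /andP[].
have zP (z : K) : z \in (x : K) :: l -> N ((z - x) / c) <= 1 ->
    N (c * y - (z - x)) = m.
  move=> zl z1; rewrite -[z - x](divfK c0) mulrC -mulrBl vabsM// cm yP ?mul1r//.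
  by rewrite mem_filter z1 andTb; apply/mapP; exists z.
have cy : N (c * y) = m.
  have := zP x (mem_head _ _); rewrite subrr mul0r vabs0 subr0; apply.
  exact: ler01.
exists (x + c * y : K) => [|z zl]; rewrite mdist_eta.
  by rewrite opprD addNKr vabsN.
rewrite (_ : _ - _ = c * y - (z - x :> K)); last by ring.
have [h|h] := leP (N ((z - x : K) / c)) 1.
  by rewrite zP// inE zl orbT.
(* Here [z] is farther than [m] from [x], and a shift by [c * y] of size [m] does not change its
   distance. *)
rewrite addrC vabs_addl// vabsN//.
  by move: h; rewrite vabsM// vabsV// cm ltr_pdivlMr// mul1r => /ltW.
by move: h; rewrite cy vabsM// vabsV// cm ltr_pdivlMr// mul1r.
Qed.

Lemma isometric_extends (F K : valuedField R) (i : {rmorphism F -> K}) :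
  extends_val i ->
  @isometric_embedding _ (eta_space eta1 F) (eta_space eta1 K) i.
Proof. by move=> iv x y; rewrite !mdist_eta -rmorphB vabs_extends. Qed.

Lemma completion_near (F K : valuedField R) (i : {rmorphism F -> K}) :
  is_completion eta1 i ->
  forall (x : K) e, 0 < e -> exists y, N (x - i y) < e.
Proof.
move=> [_ _ /denseP id] x e e0.
by have [_ [y _ <-]] := id x e e0; exists y.
Qed.

Lemma completion_value (S : set R) (F K : valuedField R) (i : {rmorphism F -> K}) :
  is_completion eta1 i -> S 0 -> (forall x : F, S (N x)) -> forall x : K, S (N x).
Proof.
move=> ic S0 FS x; have [->|x0] := eqVneq x 0; first by rewrite vabs0.
(* An approximation closer to [x] than [N x] has the same absolute value as [x]. *)
have [|y xy] := completion_near ic x (e := N x); first by rewrite vabs_gt0.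
by rewrite -(vabs_near eta1 xy); have [iv _ _] := ic; rewrite (vabs_extends _ iv).
Qed.

Lemma urysohn_field_completion S (F K : valuedField R) (i : {rmorphism F -> K}) :
  is_completion eta1 i -> S 0 -> urysohn_field S F -> urysohn_field S K.
Proof.
move=> ic S0 [FS FV Fres]; have [iv _ _] := ic.
have iN x : N (i x) = N x by exact: vabs_extends.
have near := completion_near ic; split.
- exact: completion_value ic S0 FS.
- by move=> m Sm m0; have [c <-] := FV m Sm m0; exists (i c).
(* Approximations at distance below 1 stay integral and keep their residue class. *)
move=> l l1; have /choice[f fP] (z : K) := near z 1 ltr01.
have [|y yP] := Fres (map f l).
  move=> _ /mapP[z zl ->]; rewrite -iN.
  rewrite -[i _](subrK z); apply: (vabsD_le eta1); last exact: l1.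
  by rewrite vabsBC; apply: ltW.
exists (i y) => z zl.
have -> : i y - z = i (y - f z) + (i (f z) - z) by rewrite rmorphB addrA subrK.
rewrite (vabs_addl eta1) iN yP ?map_f// vabsBC; exact: fP.
Qed.

Lemma completion_urysohn S (F K : valuedField R) (i : {rmorphism F -> K}) :
  is_completion eta1 i -> S 0 -> urysohn_field S F ->
  separable_space (eta_space eta1 F) ->
  isometric_to_urysohn S (eta_space eta1 K).
Proof.
move=> ic S0 FU Fs; have [iv Kc id] := ic.
apply: urysohn_field_space => //.
  exact: urysohn_field_completion ic S0 FU.
exact: separable_isometric_dense (isometric_extends iv) id Fs.
Qed.

End UrysohnFields.

(** * Algebraically closed valued fields *)

Section ClosedField.
Variables (L : fieldType) (Lc : GRing.closed_field_axiom L).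

Lemma closed_field_axiom_root (p : {poly L}) : (1 < size p)%N ->
  exists x, root p x.
Proof.
move=> p1; have p0 : p != 0 by rewrite -size_poly_gt0 ltnW.
(* The axiom solves [x ^+ n = \sum_(i < n) P i * x ^+ i], whence the sign and the division by the
   leading coefficient. *)
have [|x xP] := Lc (fun i => - p`_i / lead_coef p) (n := (size p).-1).
  by case: size p1.
exists x; rewrite rootE (@horner_coef_wide _ (size p).-1.+1) ?leqSpred//.
rewrite big_ord_recr /= xP.
rewrite -lead_coefE mulr_sumr -big_split big1// => i _ /=.
by rewrite mulrA mulrCA mulfV ?lead_coef_eq0// mulr1 mulNr addrN.
Qed.

Lemma closed_field_axiom_split (p : {poly L}) :
  exists r : seq L, p = lead_coef p *: \prod_(z <- r) ('X - z%:P).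
Proof.
have [n] := ubnP (size p); elim: n => // n IH in p *; rewrite ltnS => pn.
have [p1|p1] := leqP (size p) 1.
  exists [::]; rewrite big_nil alg_polyC lead_coefE.
  by case: size p1 (size1_polyC p1) => [|[]].
have [x /factor_theorem[q pE]] := closed_field_axiom_root p1.
have q0 : q != 0 by apply: contraTneq p1 => q0; rewrite pE q0 mul0r size_poly0.
have [|r qr] := IH q.
  by move: pn; rewrite pE size_mul ?polyXsubC_eq0// size_XsubC addn2.
exists (x :: r); rewrite big_cons pE lead_coefM lead_coefXsubC mulr1.
by rewrite scalerAr -qr mulrC.
Qed.

End ClosedField.

Section AlgebraicClosure.
Variables (R : realType) (eta : R) (eta1 : 1 < eta).
Local Notation N := (vabs eta).

Let eta0 : 0 < eta. Proof. exact: lt_trans eta1. Qed.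

(* A root y of prod (X - z) + 1 is integral, and the factors y - z, whose
   product is -1, are then units. *)
Lemma closed_residue_infinite (L : valuedField R) (l : seq L) :
  GRing.closed_field_axiom L -> (forall z, z \in l -> N z <= 1) ->
  exists y : L, forall z, z \in l -> N (y - z) = 1.
Proof.
move=> Lc l1; have [->|l0] := eqVneq l [::]; first by exists 0.
pose p := \prod_(z <- l) ('X - z%:P) + 1.
have sl : (0 < size l)%N by case: (l) l0.
have [|y] := closed_field_axiom_root Lc (p := p).
  by rewrite size_polyDl size_prod_XsubC ?size_poly1// ltnS.
rewrite rootE hornerD hornerC horner_prod addr_eq0 => /eqP.
under eq_bigr do rewrite hornerXsubC.
move=> /(congr1 N); rewrite vabsN vabs1 (vabs_prod eta1) => y1.
have yle : N y <= 1.
  (* For non-integral [y] every factor would have size [N y], so the product would exceed 1. *)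
  rewrite leNgt; apply/negP => y_gt1; move: y1.
  under eq_big_seq => z zl.
    rewrite (vabs_addl eta1) ?vabsN//; last exact: le_lt_trans (l1 _ zl) _.
    over.
  rewrite big_const_seq count_predT iter_mulr_1 => /eqP.
  by rewrite gt_eqF// exprn_egt1// -lt0n.
have yz z : z \in l -> N (y - z) <= 1.
  by move=> zl; apply: (vabsD_le eta1) => //; rewrite vabsN; apply: l1.
exists y => z zl; apply/eqP; rewrite eq_le yz//=.
rewrite -[leLHS]y1 (big_rem z zl) /= ler_piMr ?vabs_ge0//.
rewrite big_seq_cond prodr_ile1// => w /andP[/mem_rem wl _].
by rewrite vabs_ge0 yz.
Qed.

(** A largest term attained only once would determine the size of the sum. *)
Lemma vabs_sum_eq0 (K : valuedField R) n (F : 'I_n -> K) i :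
  \sum_k F k = 0 -> F i != 0 ->
  exists k l, [/\ k != l, F k != 0 & N (F k) = N (F l)].
Proof.
move=> F0 Fi; have [k _ kmax] :=
  @Order.TotalTheory.arg_maxP _ _ _ i xpredT (fun k => N (F k)) isT.
have {}kmax l : N (F l) <= N (F k) := kmax l isT.
have Nk : 0 < N (F k) by rewrite (lt_le_trans _ (kmax i))// vabs_gt0.
have Fk : F k != 0 by rewrite -(vabs_gt0 eta1).
apply: contrapT => h; suff : N (F k) = 0 by move/eqP; rewrite gt_eqF.
have FD : F k + \sum_(l | l != k) F l = 0.
  by rewrite -[RHS]F0 [RHS](bigD1 k).
rewrite -(vabs_addl eta1 (y := \sum_(l | l != k) F l)) ?FD ?vabs0//.
apply: (vabs_sum_lt eta1) => // l lk; rewrite lt_neqAle kmax andbT.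
by apply/eqP => lkE; apply: h; exists k, l; rewrite eq_sym.
Qed.

Lemma vabs_exprz (K : valuedField R) (c : K) (a : int) r :
  N c = eta `^ r -> N (c ^ a) = eta `^ (a%:~R * r).
Proof.
have X n : N c = eta `^ r -> N c ^+ n = eta `^ (n%:R * r).
  by move=> ->; rewrite mulrC powRrM powR_mulrn// powR_ge0.
case: a => n cr; first by rewrite -exprnP (vabsX eta1) X.
rewrite NegzE -exprnN (vabsV eta1) (vabsX eta1) X// -powRN; congr (_ `^ _).
by rewrite mulrNz mulNr.
Qed.

Section Closure.
Variables (F L : valuedField R) (j : {rmorphism F -> L}).
Hypotheses (jac : is_algebraic_closure j) (jv : extends_val j).

Let jN x : N (j x) = N x. Proof. exact: vabs_extends. Qed.

(** In an equation of [x] over [F], two nonzero terms of distinct degrees [k] and [l] have equal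
    size; solving for the valuation of [x] gives an integer divided by [k - l]. *)
Lemma closure_value (x : L) : (forall y : F, R_int eta (N y)) -> R_rat eta (N x).
Proof.
move=> FN; have [->|x0] := eqVneq x 0; first by left; rewrite vabs0.
have [p p0] := jac.2 x; rewrite rootE horner_coef size_map_poly => /eqP px.
have spP : ((size p).-1 < size p)%N by rewrite prednK ?size_poly_gt0.
have FN' i : p`_i != 0 -> exists n : int, N p`_i = eta `^ (- n%:~R).
  by move=> pi; have [/eqP|//] := FN p`_i; rewrite (vabs_eq0 eta1) (negbTE pi).
have nz i : ((map_poly j p)`_i * x ^+ i != 0) = (p`_i != 0).
  by rewrite mulf_eq0 expf_eq0 (negbTE x0) andbF orbF coef_map fmorph_eq0.
have [|k [l [kl]]] := vabs_sum_eq0 (i := Ordinal spP) px.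
  by rewrite nz -lead_coefE lead_coef_eq0.
rewrite nz => pk /esym e; have pl : p`_l != 0.
  by rewrite -nz -(vabs_gt0 eta1) e (vabs_gt0 eta1) nz.
move: e; rewrite !coef_map !(vabsM eta1) !(vabsX eta1) !jN.
have [a ->] := FN' k pk; have [b ->] := FN' l pl.
have [r _ ->] := vabs_fin eta x0.
rewrite -!powR_mulrn ?powR_ge0// -!powRrM -!(eta_powRM eta1).
move=> /(eta_powR_inj eta1) e.
right; exists ((b - a)%:~R / (k%:Z - l%:Z)%:~R); congr (_ `^ (- _)).
have kl' : (k%:Z - l%:Z)%:~R != 0 :> R.
  by rewrite intr_eq0 subr_eq0; apply: contra kl => /eqP [] /val_inj ->.
rewrite fmorph_div /= !ratr_int; apply: (mulIf kl'); rewrite divfK//.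
rewrite !rmorphB /=; move: e; lra.
Qed.

(** For an exponent [g] with denominator [d], a [d]-th root of the power [numq g] of the uniformizer
    [c] has the right size. *)
Lemma closure_value_surj (c : F) m : N c = eta^-1 -> R_rat eta m -> 0 < m ->
  exists x : L, N x = m.
Proof.
move=> c1 [->|[g ->]] m0; first by rewrite ltxx in m0.
pose d := `|denq g|%N; have d0 : (0 < d)%N by rewrite absz_gt0 denq_neq0.
have [x] := closed_field_axiom_root jac.1 (p := 'X^d - (j c ^ numq g)%:P)
  ltac:(by rewrite size_XnsubC).
rewrite rootE !hornerE subr_eq0 => /eqP/(congr1 N).
rewrite (vabsX eta1) (vabs_exprz _ (r := - 1)); last first.
  by rewrite jN c1 powR_inv1// ltW.
move=> e; exists x; have x0 : x != 0.
  rewrite -(vabs_gt0 eta1) lt0r vabs_ge0 andbT; apply/eqP => Nx; move/eqP: e.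
  by rewrite Nx expr0n gtn_eqF// eq_sym gt_eqF// powR_gt0.
move: e; have [r _ ->] := vabs_fin eta x0.
rewrite -powR_mulrn ?powR_ge0// -powRrM => /(eta_powR_inj eta1) e.
congr (_ `^ (- _)); rewrite -[g]divq_num_den fmorph_div /= !ratr_int.
have dE : (denq g)%:~R = d%:R :> R by rewrite -{1}[denq g]absz_denq.
rewrite dE; apply: (mulIf (_ : d%:R != 0)); first by rewrite pnatr_eq0 lt0n_neq0.
by rewrite divfK ?pnatr_eq0 ?lt0n_neq0//; lra.
Qed.

Lemma urysohn_field_closure (c : F) : (forall y : F, R_int eta (N y)) ->
  N c = eta^-1 -> urysohn_field eta (R_rat eta) L.
Proof.
move=> FN c1; split=> [x|m|l]; first exact: closure_value.
  exact: closure_value_surj c1.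
exact: closed_residue_infinite jac.1.
Qed.

(* Approximating the coefficients of the monic equation g of x gives a monic q
   with q(x) = (q - g)(x) small; as q(x) is a product of differences x - z, some
   root z of q is close to x. *)
Lemma separable_closure :
  separable_space (eta_space eta1 F) -> separable_space (eta_space eta1 L).
Proof.
have F0 : [set: eta_space eta1 F] !=set0 by exists 0.
move=> /(dense_sequence F0)[d dP].
(* Lists of indices into the dense sequence code countably many monic polynomials, each with
   finitely many roots in [L]. *)
pose q (s : seq nat) : {poly F} :=
  'X^(size s) + \poly_(i < size s) d (nth 0%N s i).
have qs s : size (q s) = (size s).+1.
  by rewrite size_polyDl ?size_polyXn// ltnS size_poly.
have qm s : q s \is monic.
  rewrite monicE lead_coefE qs coefD coefXn eqxx coef_poly ltnn addr0//.
have qr s : exists r : seq L, map_poly j (q s) = \prod_(z <- r) ('X - z%:P).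
  have [r qE] := closed_field_axiom_split jac.1 (map_poly j (q s)).
  by exists r; move: qE; rewrite lead_coef_map (eqP (qm s)) rmorph1 scale1r.
exists (\bigcup_(s in [set: seq nat]) [set x | root (map_poly j (q s)) x]).
  apply: bigcup_countable => // s _; have [r ->] := qr s.
  rewrite (_ : [set x | _] = [set` r]); first exact/finite_set_countable/finite_seq.
  by apply/seteqP; split=> x /=; rewrite root_prod_XsubC.
apply/denseP => x e e0.
have [p p0] := jac.2 x; rewrite rootE => /eqP px.
pose n := (size p).-1; pose X := Num.max 1 (N x).
have X0 : 0 < X by rewrite lt_max ltr01.
(* As [X] is at least 1 and [N x], every power of [x] below [n] has size at most [X ^+ n];
   coefficient errors under this bound keep the value at [x] below [e ^+ n]. *)
have eX : 0 < e ^+ n / X ^+ n by rewrite divr_gt0// exprn_gt0.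
pose g i := p`_i / lead_coef p.
have /choice[t tP] i : exists m, N (g i - d m) < e ^+ n / X ^+ n by exact: dP.
pose s := mkseq t n.
have sn : size s = n by rewrite size_mkseq.
have gx : x ^+ n + \sum_(i < n) j (g i) * x ^+ i = 0.
  have lp : j (lead_coef p) != 0 by rewrite fmorph_eq0 lead_coef_eq0.
  apply: (mulfI lp); rewrite mulr0 -[RHS]px.
  rewrite (@horner_coef_wide _ n.+1) ?size_map_poly ?leqSpred//.
  rewrite big_ord_recr /= addrC mulrDr coef_map /= -lead_coefE; congr (_ + _).
  rewrite mulr_sumr; apply: eq_bigr => i _; rewrite mulrA -rmorphM /g.
  by rewrite [lead_coef p * _]mulrC divfK ?lead_coef_eq0// coef_map.
have qx : N (map_poly j (q s)).[x] < e ^+ n.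
  have -> : (map_poly j (q s)).[x] = \sum_(i < n) j (d (t i) - g i) * x ^+ i.
    rewrite -[LHS]subr0 -[X in _ - X]gx rmorphD /= map_polyXn hornerD hornerXn sn.
    rewrite (@horner_coef_wide _ n); last by rewrite size_map_poly size_poly.
    rewrite opprD addrACA addrN add0r -sumrB; apply: eq_bigr => i _.
    by rewrite coef_map coef_poly ltn_ord nth_mkseq// rmorphB mulrBl.
  apply: (vabs_sum_lt eta1) => [|i _]; first by rewrite exprn_gt0.
  rewrite (vabsM eta1) jN vabsBC (vabsX eta1).
  have xX : N x ^+ i <= X ^+ n.
    apply: (@le_trans _ _ (X ^+ i)).
      by rewrite lerXn2r ?nnegrE ?vabs_ge0 ?(ltW X0)// le_max lexx orbT.
    by rewrite ler_weXn2l ?le_max ?lexx// ltnW.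
  apply: (@le_lt_trans _ _ (N (g i - d (t i)) * X ^+ n)).
    by rewrite ler_wpM2l ?vabs_ge0.
  by rewrite -ltr_pdivlMr ?exprn_gt0.
have [r rE] := qr s.
have rn : size r = n.
  by have := size_map_poly j (q s); rewrite qs sn rE size_prod_XsubC => -[].
(* If all [n] roots were at distance at least [e] from [x], the product would be at least
   [e ^+ n]. *)
have [z zr xz] : exists2 z, z \in r & N (x - z) < e.
  apply: contrapT => h; move: qx; apply/negP; rewrite -leNgt rE horner_prod.
  rewrite (vabs_prod eta1) -rn -(count_predT r) -iter_mulr_1 -big_const_seq.
  rewrite big_seq [leRHS]big_seq; apply: ler_prod => z zr.
  rewrite (ltW e0) /= hornerXsubC leNgt; apply/negP => xz; apply: h; by exists z.
by exists z => //; exists s => //=; rewrite rE root_prod_XsubC.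
Qed.

End Closure.
End AlgebraicClosure.

(** * Laurent series *)

Section Laurent.
Variables (R : realType) (eta : R) (eta1 : 1 < eta) (k : fieldType).
Implicit Types x y : laurent k.
Local Notation N := (@vabs R eta (laurent_tadic R k)).

Let eta0 : 0 < eta. Proof. exact: lt_trans eta1. Qed.

Lemma eta_powR_lt (e : R) : 0 < e -> exists n : int, eta `^ (- n%:~R) < e.
Proof.
move=> e0; have leta : 0 < ln eta by rewrite ln_gt0.
exists (Num.floor (- ln e / ln eta) + 1).
rewrite -ltr_ln ?posrE ?powR_gt0// ln_powR mulNr ltrNl -ltr_pdivrMr//.
exact: floorD1_gt.
Qed.

Lemma eta_powR_le (m n : int) : (eta `^ (- m%:~R) <= eta `^ (- n%:~R)) = (n <= m).
Proof.
rewrite -ler_ln ?posrE ?powR_gt0// !ln_powR ler_pM2r ?ln_gt0//.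
by rewrite lerN2 ler_int.
Qed.

Lemma laurent_vabs x (a : int) : x a != 0 -> (forall n : int, n < a -> x n = 0) ->
  N x = eta `^ (- a%:~R).
Proof. by move=> xa0 xa; rewrite /vabs /= (tadic_val_order R xa0 xa). Qed.

(** This turns closed balls into conditions on coefficients, on which the density and completeness
    arguments rest. *)
Lemma laurent_vabs_le x (a : int) :
  N x <= eta `^ (- a%:~R) <-> (forall n : int, n < a -> x n = 0).
Proof.
have [->|/laurent_order[b xb0 xb]] := eqVneq x 0.
  by rewrite (vabs0 _ (laurent_tadic R k)) powR_ge0.
rewrite (laurent_vabs xb0 xb) eta_powR_le; split=> [ab n na|xa].
  by apply: xb; exact: lt_le_trans ab.
by rewrite leNgt; apply: contra xb0 => /xa ->.
Qed.

Lemma laurent_of_bounded (f : int -> k) (a : int) :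
  (forall n : int, n < a -> f n = 0) -> exists x, forall n, x n = f n.
Proof.
move=> fa; have fb : bounded_below f by exists a.
by exists (Laurent (asboolT fb)).
Qed.

Lemma laurent_monomial (c : k) (a : int) :
  exists x, forall n, x n = if n == a then c else 0.
Proof.
apply: (@laurent_of_bounded (fun n => if n == a then c else 0) a) => n na.
by rewrite lt_eqF.
Qed.

Lemma laurent_value (x : laurent_tadic R k) : R_int eta (N x).
Proof.
have [->|/(@laurent_order k x)[b xb0 xb]] := eqVneq x 0.
  by left; rewrite vabs0.
by right; exists b; rewrite (laurent_vabs xb0 xb).
Qed.

Lemma laurent_value_surj (a : int) :
  exists x : laurent_tadic R k, N x = eta `^ (- a%:~R).
Proof.
have [x xE] := laurent_monomial 1 a; exists x.
by apply: laurent_vabs => [|n na]; rewrite xE ?eqxx ?oner_neq0// lt_eqF.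
Qed.

Lemma laurent_uniformizer : exists c : laurent_tadic R k, N c = eta^-1.
Proof.
by have [c cE] := laurent_value_surj 1; exists c; rewrite cE powR_inv1// ltW.
Qed.

Lemma laurentBE x y n : (x - y) n = x n - y n. Proof. by []. Qed.

Hypothesis k_nat : ([set: k] #= [set: nat])%card.

Lemma urysohn_field_laurent : urysohn_field eta (R_int eta) (laurent_tadic R k).
Proof.
split=> [x|m|l l1]; first exact: laurent_value.
  by move=> [->|[a ->]]; rewrite ?ltxx// => _; exact: laurent_value_surj.
(* The residue of an integral series is its constant coefficient; the infinite field [k] has an
   element [c] that avoids those of [l]. *)
have [c cl] : exists c : k, c \notin [seq (z : laurent k) 0 | z <- l].
  apply: contrapT => h; apply: infinite_nat; rewrite -(eq_finite_set k_nat).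
  apply: (sub_finite_set _ (finite_seq [seq (z : laurent k) 0 | z <- l])).
  by move=> c _ /=; apply: contrapT => /negP cl; apply: h; exists c.
have [y yE] := laurent_monomial c 0; exists y => z zl.
have z0 (n : int) : n < 0 -> (z : laurent k) n = 0.
  by apply: (laurent_vabs_le z 0).1; rewrite mulr0z oppr0 powRr0 l1.
rewrite -[RHS](powRr0 eta) -oppr0; apply: (@laurent_vabs _ 0) => [|n n0].
  rewrite laurentBE yE eqxx subr_eq0; apply: contra cl => /eqP ->.
  by apply/mapP; exists z.
by rewrite laurentBE yE lt_eqF// z0// subr0.
Qed.

Lemma separable_laurent : separable_space (eta_space eta1 (laurent_tadic R k)).
Proof.
have kc : countable [set: k] by rewrite (eq_countable k_nat).
have /countable_injP[h hi] := kc.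
have /choice[g gP] n : exists c : k, forall c', h c' = n -> c = c'.
  have [[c cn]|H] := pselect (exists c, h c = n).
    by exists c => c' c'n; apply: hi; rewrite ?inE// cn.
  by exists 0 => c cn; case: H; exists c.
have gh c : g (h c) = c by exact: gP.
(* A list of codes and a starting index describe a Laurent polynomial; the default 0 of [nth] ends
   it. *)
have /choice[t tP] (sa : seq nat * int) : exists x, forall n,
    x n = if n < sa.2 then 0 else (map g sa.1)`_`|(n - sa.2)%R|%N.
  by apply: (@laurent_of_bounded _ sa.2) => n ->.
exists (range t); first exact/(card_le_trans (card_image_le _ _))/countableP.
apply/denseP => x e /eta_powR_lt[M Me].
have [a xa] := lcoef_below (x : laurent k).
(* Truncation of [x] before index [M]. If [M < a], the length is immaterial, as [x] and the
   truncation both vanish below [a]. *)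
pose s := mkseq (fun i : nat => h ((x : laurent k) (a + i%:Z))) `|M - a|%N.
exists (t (s, a)); first by exists (s, a).
rewrite mdist_eta; apply: le_lt_trans Me; apply/laurent_vabs_le => n nM.
rewrite laurentBE tP /=; case: ltP => na; first by rewrite xa// subr0.
rewrite -map_comp (nth_map 0%N) ?size_iota; last by lia.
rewrite /= gh nth_iota; last by lia.
by rewrite add0n (_ : a + _ = n) ?subrr//; lia.
Qed.

Lemma complete_laurent : complete_space (eta_space eta1 (laurent_tadic R k)).
Proof.
move=> F FF Fc.
have /choice[A AP] (m : int) : exists A, F A /\
    forall x y : laurent k, A x -> A y -> forall n : int, n < m -> x n = y n.
  have /cauchy_ballP /(_ _ (powR_gt0 (- m%:~R) eta0))[[P Q] /= [FP FQ] PQ] := Fc.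
  (* The Cauchy condition compares a point of [P] with one of [Q], so two arbitrary points have to
     lie in both. *)
  exists (P `&` Q); split; first exact: filterI.
  move=> x y [Px _] [_ Qy] n nm; have := PQ (x, y) (conj Px Qy).
  rewrite /= ballEmdist /= mdist_eta => /ltW /laurent_vabs_le /(_ n nm).
  by rewrite laurentBE => /eqP; rewrite subr_eq0 => /eqP.
have /choice[x xP] m : exists x, A m x by exact: (filter_ex (AP m).1).
have xE (m m' n : int) : n < m -> n < m' ->
    (x m : laurent k) n = (x m' : laurent k) n.
  move=> nm nm'; have [y [Ay Ay']] := filter_ex (filterI (AP m).1 (AP m').1).
  by rewrite ((AP m).2 _ _ (xP m) Ay _ nm) ((AP m').2 _ _ Ay' (xP m') _ nm').
have [a xa] := lcoef_below (x 0 : laurent k).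
(* [A m] fixes the coefficients below [m], so the one at [n] is read off [x (n + 1)]. For [n < 0] it
   is also that of [x 0], which vanishes below [a]. *)
have [|l lE] :=
    @laurent_of_bounded (fun n => (x (n + 1) : laurent k) n) (Num.min a 0).
  by move=> n; rewrite lt_min => /andP[na n0]; rewrite (xE _ 0) ?ltrDl// xa.
exists l; apply/fcvgrPdist_lt => e /eta_powR_lt[M Me].
apply: filterS (AP M).1 => y Ay; rewrite mdist_eta.
apply: le_lt_trans Me; apply/laurent_vabs_le => n nM.
rewrite laurentBE lE (xE _ M) ?ltrDl//.
by rewrite ((AP M).2 _ _ (xP M) Ay n nM) subrr.
Qed.

End Laurent.

(** * The p-adic fields *)

(** A nonconstant divisor of least size is irreducible. *)
Lemma irreducible_dvdp (F : fieldType) (p : {poly F}) : (1 < size p)%N ->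
  exists2 q, irreducible_poly q & q %| p.
Proof.
move=> p1; have p0 : p != 0 by rewrite -size_poly_gt0 ltnW.
have : exists n, `[< exists q : {poly F},
    [/\ q %| p, (1 < size q)%N & size q = n] >].
  by exists (size p); apply/asboolP; exists p; rewrite dvdpp.
case/ex_minnP => n /asboolP[q [qp q1 qn]] nmin; exists q => //; split=> // d d1 dq.
have q0 : q != 0 by rewrite -size_poly_gt0 ltnW.
rewrite -dvdp_size_eqp// eqn_leq dvdp_leq//= qn; apply: nmin; apply/asboolP.
exists d; split=> //; first exact: dvdp_trans qp.
by rewrite ltn_neqAle eq_sym d1 size_poly_gt0 (dvdpN0 dq).
Qed.

(* Euclid: an irreducible factor of 'X times all nonzero polynomials of size at
   most n, plus 1, has size greater than n. *)
Lemma irreducible_poly_large (F : finFieldType) n :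
  exists2 q : {poly F}, irreducible_poly q & (n < size q)%N.
Proof.
pose P := \prod_(v : 'rV[F]_n | v != 0) rVpoly v.
have P0 : P != 0.
  apply/prodf_neq0 => v; apply: contra_neq => /(congr1 (@poly_rV F n)).
  by rewrite rVpolyK linear0.
have [|q qi qd] := irreducible_dvdp (p := P * 'X + 1).
  by rewrite size_polyDl size_mulX// ?size_poly1 ltnS size_poly_gt0.
exists q => //; rewrite ltnNge; apply/negP => qn.
have q0 := irredp_neq0 qi.
have qP : q %| P.
  rewrite /P (bigD1 (poly_rV q)) /=; first by rewrite poly_rV_K// dvdp_mulr.
  by apply: contra_neq q0 => /(congr1 rVpoly); rewrite poly_rV_K// linear0.
have /eqP := qi.1; move: qd; rewrite dvdp_addr ?dvdp_mulr// dvdp1 => /eqP ->.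
by [].
Qed.

(** * Integers in a valued field of residue characteristic p *)

Section ResidueCharacteristic.
Variables (R : realType) (eta : R) (eta1 : 1 < eta) (p : nat).
Hypothesis p_prime : prime p.
Local Notation N := (vabs eta).

Lemma intr_Fp_eq0 (z : int) : ((z%:~R : 'F_p) == 0) = (p %| `|z|)%N.
Proof.
have pF := pchar_Fp p_prime.
by case: z => n; rewrite ?NegzE ?rmorphN ?oppr_eq0 ?abszN (dvdn_pcharf pF).
Qed.

Lemma vabs_intr_lt1 (K : valuedField R) (z : int) : N (p%:R : K) < 1 ->
  (N (z%:~R : K) < 1) = (p %| `|z|)%N.
Proof.
move=> p1; apply/idP/idP => [z1|/dvdnP[m zE]]; last first.
  have -> : N (z%:~R : K) = N (`|z|%N%:R : K).
    by case: z {zE} => n; rewrite // NegzE rmorphN abszN vabsN.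
  rewrite zE natrM (vabsM eta1) (le_lt_trans _ p1)//.
  by rewrite ler_piMl ?vabs_ge0 ?(vabs_natr_le1 eta1).
apply: contraLR z1 => pz; rewrite -leNgt.
have : coprimez p z by rewrite /coprimez /gcdz eqz_nat -/(coprime _ _) prime_coprime.
(* If [p] and [z] both had size below 1, this Bezout relation would give 1 a size below 1. *)
case/coprimezP => -[u w] /= uw.
have := congr1 (fun x : int => x%:~R : K) uw; rewrite rmorphD !rmorphM /= => e.
rewrite leNgt; apply/negP => z1; have : N (1 : K) < 1; last by rewrite vabs1 ltxx.
rewrite -[X in N X]e; apply: (vabsD_lt eta1).
- by rewrite (vabsM eta1) (le_lt_trans _ p1)// ler_piMl ?vabs_ge0 ?(vabs_intr_le1 eta1).
- by rewrite (vabsM eta1) (le_lt_trans _ z1)// ler_piMl ?vabs_ge0 ?(vabs_intr_le1 eta1).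
Qed.

Lemma vabs_intr_eq1 (K : valuedField R) (z : int) : N (p%:R : K) < 1 ->
  ~~ (p %| `|z|)%N -> N (z%:~R : K) = 1.
Proof.
move=> p1; rewrite -(vabs_intr_lt1 _ p1) -leNgt => z1.
by apply/eqP; rewrite eq_le z1 (vabs_intr_le1 eta1).
Qed.

End ResidueCharacteristic.

Section PadicFields.
Variables (R : realType) (eta : R) (eta1 : 1 < eta) (p : nat).
Hypothesis p_prime : prime p.
Local Notation N := (vabs eta).
Local Notation rat_p := (rat_padic R p_prime).

Let eta0 : 0 < eta. Proof. exact: lt_trans eta1. Qed.

Lemma rat_padic_value (x : rat_p) : R_int eta (N x).
Proof.
rewrite /vabs /= /padic_val; case: eqP => _ /=; first by left.
right; exists ((logn p `|numq x|)%:Z - (logn p `|denq x|)%:Z).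
by rewrite rmorphB.
Qed.

Lemma rat_padic_uniformizer : N (p%:R : rat_p) = eta^-1.
Proof.
rewrite /vabs /= /padic_val.
have -> : (p%:R : rat) = p%:Q by [].
rewrite intr_eq0 eqz_nat gtn_eqF ?prime_gt0// numq_int denq_int /=.
by rewrite logn1 subr0 logn_prime// eqxx powR_inv1// ltW.
Qed.

Let inv_eta_lt1 : eta^-1 < 1. Proof. by rewrite invf_lt1. Qed.

Lemma rat_padic_residue (x : rat_p) : N x <= 1 ->
  exists z : int, N (x - z%:~R : rat_p) < 1.
Proof.
have p1 : N (p%:R : rat_p) < 1 by rewrite rat_padic_uniformizer.
move=> x1; pose a := numq x; pose b := denq x.
have b0 : (b%:~R : rat_p) != 0 by rewrite intr_eq0 denq_neq0.
have axb : a%:~R = x * b%:~R :> rat_p.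
  by rewrite -[X in X * _]divq_num_den divfK.
(* Otherwise [p] does not divide [a], so [a] has size 1, whereas [x * b] has size below 1. *)
have pb : ~~ (p %| `|b|)%N.
  apply/negP => pb; have : N (b%:~R : rat_p) < 1 by rewrite (vabs_intr_lt1 eta1 p_prime).
  have pa : ~~ (p %| `|a|)%N.
    apply/negP => pa; have := coprime_num_den x.
    move/(coprime_dvdl pa)/(coprime_dvdr pb); rewrite /coprime gcdnn => /eqP p_eq1.
    by move: p_prime; rewrite p_eq1.
  move=> b1; have := vabs_intr_eq1 eta1 p_prime p1 pa.
  rewrite axb (vabsM eta1) => /eqP; rewrite lt_eqF// (le_lt_trans _ b1)//.
  by rewrite ler_piMl ?vabs_ge0.
have [[u w] /= uw] : exists uw, uw.1 * p%:Z + uw.2 * b = 1.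
  have : coprimez p b by rewrite /coprimez /gcdz eqz_nat -/(coprime _ _) prime_coprime.
  by case/coprimezP => uw; exists uw.
(* [w] inverts the denominator modulo [p], so [x] minus [a * w] equals [x * u * p]. *)
exists (a * w).
have -> : x - (a * w)%:~R = x * (u%:~R * p%:R) :> rat_p.
  have /(canRL (addrK _)) -> : u%:~R * p%:R + w%:~R * b%:~R = 1 :> rat_p.
    by rewrite -[p%:R]/(p%:Z%:~R) -!rmorphM -rmorphD uw.
  rewrite mulrBr mulr1; congr (_ - _).
  by rewrite rmorphM /= axb -mulrA [_ * b%:~R]mulrC.
rewrite !(vabsM eta1) (le_lt_trans _ p1)//.
rewrite mulrA ler_piMl ?vabs_ge0// mulr_ile1 ?vabs_ge0//.
exact: vabs_intr_le1.
Qed.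

Lemma separable_rat_padic : separable_space (eta_space eta1 rat_p).
Proof.
exists setT; first exact: (@countableP rat).
by apply/denseP => x e e0; exists x => //; rewrite mdistxx.
Qed.

Section Qp.
Variable Qp : valuedField R.
Hypothesis QpP : is_Qp eta1 p_prime Qp.

Lemma Qp_value (x : Qp) : R_int eta (N x).
Proof.
have [i ic] := QpP; apply: (completion_value ic); first by left.
exact: rat_padic_value.
Qed.

Lemma Qp_uniformizer : N (p%:R : Qp) = eta^-1.
Proof.
have [i [iv _ _]] := QpP.
by rewrite -rat_padic_uniformizer -(vabs_extends eta iv) rmorph_nat.
Qed.

Lemma Qp_residue (x : Qp) : N x <= 1 -> exists z : int, N (x - z%:~R) < 1.
Proof.
have [i ic] := QpP; have [iv _ _] := ic.
move=> x1; have [y xy] := completion_near ic x ltr01.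
have [|z yz] := @rat_padic_residue y.
  rewrite -(vabs_extends eta iv) -[i y](subrK x); apply: (vabsD_le eta1) => //.
  by rewrite vabsBC ltW.
exists z; rewrite -(subrK (i y) x) -addrA; apply: (vabsD_lt eta1) => //.
by rewrite -(rmorph_int i) -rmorphB (vabs_extends eta iv).
Qed.

Lemma separable_Qp : separable_space (eta_space eta1 Qp).
Proof.
have [i [iv _ id]] := QpP.
exact: separable_isometric_dense (isometric_extends iv) id separable_rat_padic.
Qed.

End Qp.

(** * Adjoining a root of a lifted irreducible polynomial *)

Section UnramifiedGenerator.
Variables (K : valuedField R) (h : {poly int}) (a : K).
Hypotheses (p1 : N (p%:R : K) < 1) (h_monic : h \is monic)
  (h_irr : irreducible_poly (map_poly intr h : {poly 'F_p}))
  (ha : root (map_poly intr h) a).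
Local Notation ev P := ((map_poly intr P).[a] : K).

(** If [a] had size above 1, the leading term of the monic [h] would outweigh all others. *)
Lemma integral_root_le1 : N a <= 1.
Proof.
rewrite leNgt; apply/negP => a1; have a0 : 0 < N a by exact: lt_trans a1.
have h0 : (0 < size h)%N by rewrite size_poly_gt0 monic_neq0.
move/eqP: ha; rewrite (@horner_coef_wide _ (size h).-1.+1); last first.
  by rewrite (leq_trans (size_poly _ _)) ?prednK.
rewrite big_ord_recr /= !coef_map /= -lead_coefE (eqP h_monic) mul1r.
move/eqP; rewrite addrC addr_eq0 => /eqP /(congr1 N); rewrite vabsN (vabsX eta1) => e.
suff : N a ^+ (size h).-1 < N a ^+ (size h).-1 by rewrite ltxx.
rewrite {1}e; apply: (vabs_sum_lt eta1) => [|i _]; first exact: exprn_gt0.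
rewrite coef_map (vabsM eta1) (vabsX eta1).
apply: (@le_lt_trans _ _ (N a ^+ i)).
  by rewrite ler_piMl ?exprn_ge0 ?vabs_ge0// (vabs_intr_le1 eta1).
by rewrite ltr_eXn2l.
Qed.

Lemma ev_le1 P : N (ev P) <= 1.
Proof.
rewrite horner_coef; apply: (vabs_sum_le eta1) => // i _.
rewrite coef_map (vabsM eta1) (vabsX eta1).
rewrite mulr_ile1 ?exprn_ge0 ?vabs_ge0 ?(vabs_intr_le1 eta1)//.
by rewrite exprn_ile1 ?vabs_ge0 ?integral_root_le1.
Qed.

Lemma ev_lt1 P : map_poly intr P = 0 :> {poly 'F_p} -> N (ev P) < 1.
Proof.
move=> P0; rewrite horner_coef; apply: (vabs_sum_lt eta1) => // i _.
rewrite coef_map (vabsM eta1) (vabsX eta1).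
have Pi : N ((P`_i)%:~R : K) < 1.
  rewrite (vabs_intr_lt1 eta1 p_prime)// -intr_Fp_eq0//.
  by rewrite -(coef_map (intr : int -> 'F_p)) P0 coef0.
rewrite (le_lt_trans _ Pi)// ler_piMr ?vabs_ge0//.
by rewrite exprn_ile1 ?vabs_ge0 ?integral_root_le1.
Qed.

Lemma poly_Fp_lift (q : {poly 'F_p}) : exists P : {poly int}, map_poly intr P = q.
Proof.
exists (\poly_(i < size q) (nat_of_ord (q`_i)%R)%:Z); apply/polyP => i.
rewrite coef_map coef_poly /=.
case: ltnP => [_|/leq_sizeP/(_ i (leqnn _)) ->]; last exact: rmorph0.
by rewrite -pmulrn natr_Zp.
Qed.

(* Bezout modulo p makes P(a) invertible among the integral elements. *)
Lemma ev_eq1 P : map_poly intr P != 0 :> {poly 'F_p} -> (size P < size h)%N ->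
  N (ev P) = 1.
Proof.
move=> P0 Ph; pose hF : {poly 'F_p} := map_poly intr h.
have shF : size hF = size h.
  by rewrite size_map_poly_id0// (eqP h_monic) rmorph1 oner_neq0.
have cop : coprimep hF (map_poly intr P).
  rewrite irreducible_poly_coprime//; apply/negP => /(dvdp_leq P0).
  by rewrite leqNgt (leq_ltn_trans (size_poly _ _))// shF.
have [[u w] /=] := Bezout_eq1_coprimepP _ _ cop.
have [U <-] := poly_Fp_lift u; have [W <-] := poly_Fp_lift w => uw.
have [|] := ltP (N (ev P)) 1; last by move=> h1; apply/eqP; rewrite eq_le ev_le1.
(* This combination vanishes modulo [p] and [h] vanishes at [a], so the values of [W] and [P]
   multiply to 1 up to an error below 1. *)
move=> P1; have := @ev_lt1 (U * h + W * P - 1).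
rewrite rmorphB rmorphD !rmorphM rmorph1 uw subrr => /(_ erefl) e.
have : N (1 : K) < 1; last by rewrite vabs1 ltxx.
rewrite -vabsN -[- 1](addKr (ev (W * P))) addrC; apply: (vabsD_lt eta1).
  move: e; rewrite rmorphB rmorphD !rmorphM rmorph1 !hornerE (eqP ha).
  by rewrite mulr0 add0r.
rewrite vabsN rmorphM hornerM (vabsM eta1) (le_lt_trans _ P1)//.
by rewrite ler_piMl ?vabs_ge0 ?ev_le1.
Qed.

Section Base.
Variables (F : valuedField R) (j : {rmorphism F -> K}).
Hypotheses (jv : extends_val j)
  (F_residue : forall x : F, N x <= 1 -> exists z : int, N (x - z%:~R) < 1).

(* The powers of a below the degree of h are orthogonal. *)
Lemma horner_value (q : {poly F}) : q != 0 -> (size q < size h)%N ->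
  exists2 i, q`_i != 0 & N (map_poly j q).[a] = N q`_i.
Proof.
move=> q0 qh; have jN x : N (j x) = N x by exact: vabs_extends.
have sq : ((size q).-1 < size q)%N by rewrite prednK ?size_poly_gt0.
(* Division by a largest coefficient makes all coefficients integral and this one equal to 1. *)
have [i _ imax] := @Order.TotalTheory.arg_maxP _ _ _ (Ordinal sq) xpredT
  (fun i : 'I_(size q) => N q`_i) isT.
have {}imax l : N q`_l <= N q`_i.
  have [lq|ql] := ltnP l (size q); first exact: (imax (Ordinal lq) isT).
  by rewrite nth_default// vabs0 vabs_ge0.
have qi : q`_i != 0.
  rewrite -(vabs_gt0 eta1) (lt_le_trans _ (imax (size q).-1))//.
  by rewrite (vabs_gt0 eta1) -lead_coefE lead_coef_eq0.
exists i => //; pose b l := q`_l / q`_i.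
have b1 l : N (b l) <= 1.
  by rewrite (vabsM eta1) (vabsV eta1) ler_pdivrMr ?mul1r// (vabs_gt0 eta1).
(* Integers represent the residues of the scaled coefficients; the one at [i] is nonzero modulo [p],
   so [P] survives reduction. *)
have /choice[z zP] l := F_residue (b1 l).
pose P := \poly_(l < size q) z l.
have PF : map_poly intr P != 0 :> {poly 'F_p}.
  apply/eqP => /polyP /(_ i); rewrite coef_map coef_poly ltn_ord coef0 => /eqP.
  rewrite intr_Fp_eq0// -(vabs_intr_lt1 eta1 p_prime _ (K := F)); last first.
    by rewrite -jN rmorph_nat.
  have := zP i; rewrite /b divff// => h1 h2.
  have : N (1 : F) < 1; last by rewrite vabs1 ltxx.
  by rewrite -[1](subrK (z i)%:~R); apply: (vabsD_lt eta1).
have evP : N (ev P) = 1.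
  by apply: ev_eq1 => //; exact: leq_ltn_trans (size_poly _ _) qh.
have -> : (map_poly j q).[a] = j q`_i * (map_poly j ((q`_i)^-1 *: q)).[a].
  by rewrite map_polyZ hornerZ mulrA -rmorphM divff// rmorph1 mul1r.
rewrite (vabsM eta1) jN -[RHS]mulr1; congr (_ * _); rewrite -evP.
(* The scaled polynomial and [P] differ by coefficients of size below 1, and [a] is integral. *)
apply: (vabs_near eta1); rewrite evP -hornerN -hornerD horner_coef.
apply: (vabs_sum_lt eta1) => // l _; rewrite (vabsM eta1) (vabsX eta1).
rewrite coefD coefN !coef_map coefZ coef_poly [_^-1 * _]mulrC -/(b l).
have bl : N ((if (l < size q)%N then z l else 0)%:~R - j (b l)) < 1.
  case: ltnP => [_|ql].
    by rewrite -[_%:~R](rmorph_int j) -rmorphB jN vabsBC.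
  by rewrite /b nth_default// mul0r !rmorph0 subrr vabs0.
rewrite (le_lt_trans _ bl)// ler_piMr ?vabs_ge0//.
by rewrite exprn_ile1 ?vabs_ge0 ?integral_root_le1.
Qed.

(** By [horner_value] no nonzero polynomial of smaller degree vanishes at [a], so [g] is
    irreducible. Each nonzero element of the extension is the value at [a] of a remainder modulo
    [g], hence has the size of one of its coefficients. *)
Lemma unramified_generator : exists (E : fieldExtType F) (f : {rmorphism E -> K}),
  [/\ forall x : F, f x%:A = j x, unramified f & range f a].
Proof.
pose g := map_poly intr h : {poly F}.
have sg : size g = size h.
  by rewrite size_map_poly_id0// (eqP h_monic) rmorph1 oner_neq0.
have g0 : g != 0 by rewrite -size_poly_gt0 sg size_poly_gt0 monic_neq0.
have ga : root (map_poly j g) a.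
  rewrite -map_poly_comp (eq_map_poly (_ : _ =1 intr))// => x /=.
  by rewrite rmorph_int.
have gi : irreducible_poly g.
  apply/(subfx_irreducibleP ga g0) => q qa q0; rewrite leqNgt; apply/negP.
  rewrite sg => qh; have [i qi] := horner_value q0 qh.
  by rewrite (eqP qa) vabs0 => /esym/eqP; rewrite (vabs_eq0 eta1) (negbTE qi).
exists (SubFieldExtType ga gi), (@subfx_inj F K j a g).
split.
- by move=> x; apply: subfx_inj_base.
- apply/seteqP; split=> [_ [x x0 <-]|_ [y y0 <-]] /=.
    have [q xq] := subfxE x.
    have fx : subfx_inj x = (map_poly j (q %% g)).[a].
      rewrite xq subfx_inj_eval// {1}(divp_eq q g) rmorphD rmorphM /=.
      by rewrite hornerD hornerM (eqP ga) mulr0 add0r.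
    have [||i qi e] := @horner_value (q %% g).
    + apply: contraNneq x0 => q0; move: fx; rewrite q0 rmorph0 horner0.
      by move/eqP; rewrite fmorph_eq0.
    + by rewrite -sg ltn_modp.
    exists ((q %% g)`_i) => //.
    by have := vval_vabs eta1 e; rewrite -fx => /esym.
  exists (y%:A : SubFieldExtType ga gi) => /=.
    by rewrite scaler_eq0 oner_eq0 orbF.
  by rewrite subfx_inj_base// jv.
- by exists (subfx_root j a g) => //; exact: (subfx_inj_root ga g0).
Qed.

End Base.
End UnramifiedGenerator.
End PadicFields.

(** * The maximal unramified extension and the algebraic closure of Q_p *)

Section UnramifiedExtension.
Variables (R : realType) (eta : R) (eta1 : 1 < eta) (p : nat).
Hypothesis p_prime : prime p.
Local Notation N := (vabs eta).

Lemma irreducible_Fp_lift n : exists h : {poly int},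
  [/\ h \is monic, irreducible_poly (map_poly intr h : {poly 'F_p})
    & (n < size h)%N].
Proof.
have [q qi nq] := irreducible_poly_large 'F_p n.
have q0 := irredp_neq0 qi.
have q1 : (0 < size q)%N by rewrite size_poly_gt0.
pose q' := (lead_coef q)^-1 *: q.
have lq : lead_coef q != 0 by rewrite lead_coef_eq0.
have q'q : q' %= q by rewrite eqp_scale// invr_eq0.
have q'i : irreducible_poly q'.
  split; first by rewrite (eqp_size q'q) qi.1.
  by move=> d d1 dq; rewrite (eqp_rtrans q'q); apply: qi.2; rewrite -?(eqp_dvdr _ q'q).
have [H Hq] := poly_Fp_lift q'.
(* The lift [H] is only known modulo [p]; replacing its top part by a leading 1 makes it monic of
   the same degree as [q]. *)
pose G := 'X^((size q).-1) + \poly_(i < (size q).-1) H`_i.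
have sG : size G = size q.
  by rewrite size_polyDl ?size_polyXn ?ltnS ?size_poly// prednK.
exists G; split.
- rewrite monicE lead_coefE sG coefD coefXn eqxx coef_poly ltnn addr0//.
- suff -> : map_poly intr G = q' by [].
  apply/polyP => i; rewrite coef_map coefD coefXn coef_poly /= intrD.
  case: ltngtP => [iq|iq|->].
  + by rewrite add0r -Hq coef_map.
  + by rewrite addr0 nth_default// (eqp_size q'q) -(prednK q1).
  + by rewrite addr0 /q' coefZ -lead_coefE mulVf.
- by rewrite sG.
Qed.

Variables (Qp L : valuedField R) (j : {rmorphism Qp -> L}).
Hypothesis jP : is_Qp_bar eta1 p_prime j.

Let jv : extends_val j. Proof. by have [] := jP. Qed.
Let QpP : is_Qp eta1 p_prime Qp. Proof. by have [] := jP. Qed.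
Let jac : is_algebraic_closure j. Proof. by have [] := jP. Qed.

Lemma Qp_bar_uniformizer : N (p%:R : L) = eta^-1.
Proof. by rewrite -(rmorph_nat j) (vabs_extends _ jv) (Qp_uniformizer QpP). Qed.

Lemma max_unramified_spread n : exists y : 'I_n -> L,
  [/\ forall i, max_unramified j (y i), forall i, N (y i) <= 1
    & forall i k, i != k -> N (y i - y k) = 1].
Proof.
have p1 : N (p%:R : L) < 1 by rewrite Qp_bar_uniformizer invf_lt1// (lt_trans ltr01).
have [h [hm hi nh]] := irreducible_Fp_lift n.
have sh : size (map_poly intr h : {poly L}) = size h.
  by rewrite size_map_poly_id0// (eqP hm) rmorph1 oner_neq0.
have h1 : (1 < size h)%N by apply: leq_trans hi.1 (size_poly _ _).
have [a ha] : exists a, root (map_poly intr h : {poly L}) a.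
  by apply: closed_field_axiom_root jac.1 _ _; rewrite sh.
have Qres := Qp_residue QpP.
have a1 := integral_root_le1 eta1 hm ha.
exists (fun i => a ^+ i); split=> [i|i|i k ik].
- have [E [f [fj fu [e _ ea]]]] := unramified_generator eta1 p_prime p1 hm hi ha jv Qres.
  by exists E, f; split => //; exists (e ^+ i) => //; rewrite rmorphXn ea.
- by rewrite (vabsX eta1) exprn_ile1 ?vabs_ge0.
(* Orthogonality of the powers of [a] gives the difference the size of a nonzero coefficient, which
   is 1 or -1. *)
pose q : {poly Qp} := 'X^i - 'X^k.
have qE l : q`_l = (l == i)%:R - (l == k)%:R by rewrite coefB !coefXn.
have ikN : (i == k :> nat) = false by exact/negbTE.
have q0 : q != 0.
  by apply/eqP => /polyP/(_ i)/eqP; rewrite qE coef0 eqxx ikN subr0 oner_eq0.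
have qh : (size q < size h)%N.
  apply: leq_ltn_trans nh; rewrite (leq_trans (size_polyD _ _))//.
  by rewrite size_polyN !size_polyXn geq_max !ltn_ord.
have [l ql] := horner_value eta1 p_prime p1 hm hi ha jv Qres q0 qh.
have <- : (map_poly j q).[a] = a ^+ i - a ^+ k.
  by rewrite rmorphB /= !map_polyXn hornerD hornerN !hornerXn.
move=> ->; move: ql; rewrite qE.
have [->|_] := eqVneq l i; first by rewrite ikN subr0 vabs1.
by have [_|_] := eqVneq l k; rewrite ?subrr ?eqxx// sub0r vabsN vabs1.
Qed.

Lemma urysohn_field_unr (U : valuedField R) (u : {rmorphism U -> L}) :
  extends_val u -> range u = max_unramified j -> urysohn_field eta (R_int eta) U.
Proof.
move=> uv uE; have uN x : N (u x) = N x by exact: vabs_extends.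
split=> [x|m [->|[n ->]]|l l1].
- have [->|x0] := eqVneq x 0; first by left; rewrite vabs0.
  have : max_unramified j (u x) by rewrite -uE; exists x.
  move=> [E [f [_ fu [e _ ex]]]].
  have : [set vval (f x) | x in [set x : E | x != 0]] (vval (u x)).
    exists e; rewrite ?ex//=; apply: contraNneq x0 => e0.
    by rewrite -(fmorph_eq0 u) -ex e0 rmorph0.
  rewrite fu => -[y _ yu].
  have -> : N x = N y by rewrite -uN /vabs yu.
  exact: Qp_value QpP y.
- by rewrite ltxx.
- move=> _; exists (p%:R ^ n).
  rewrite (vabs_exprz eta1 _ (r := - 1)) ?mulrN1//.
  rewrite -uN rmorph_nat Qp_bar_uniformizer powR_inv1// ltW// (lt_trans ltr01)//.
(* Pigeonhole: one more residue class than [l] has elements, so some class contains none of them. *)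
have [y [ym y1 yy]] := max_unramified_spread (size l).+1.
have /choice[w wy] i : exists w, u w = y i.
  by have := ym i; rewrite -uE => -[w _ wy]; exists w.
have ww i k : i != k -> N (w i - w k) = 1.
  by move=> ik; rewrite -uN rmorphB !wy yy.
have wz i z : z \in l -> N (w i - z) <= 1.
  move=> zl; apply: (vabsD_le eta1); first by rewrite -uN wy.
  by rewrite vabsN l1.
have [i iP] : exists i, forall z, z \in l -> 1 <= N (w i - z).
  apply: contrapT => nh.
  have /choice[g gP] i : exists k : 'I_(size l), N (w i - l`_k) < 1.
    apply: contrapT => h; apply: nh; exists i => z zl; rewrite leNgt; apply/negP => wiz.
    have zi : (index z l < size l)%N by rewrite index_mem.
    by apply: h; exists (Ordinal zi); rewrite /= nth_index.
  have gi : injective g.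
    move=> i k gik; apply/eqP/negPn/negP => /ww; apply/eqP; rewrite lt_eqF//.
    rewrite -[w i](subrK l`_(g i)) -addrA; apply: (vabsD_lt eta1); first exact: gP.
    by rewrite gik vabsBC; exact: gP.
  by have := leq_card g gi; rewrite !card_ord ltnn.
by exists (w i) => z zl; apply/eqP; rewrite eq_le wz// iP.
Qed.

Lemma separable_Qp_bar : separable_space (eta_space eta1 L).
Proof. exact: separable_closure jac jv (separable_Qp QpP). Qed.

Lemma urysohn_field_Qp_bar : urysohn_field eta (R_rat eta) L.
Proof.
exact (urysohn_field_closure eta1 jac jv (Qp_value QpP) (Qp_uniformizer QpP)).
Qed.

End UnramifiedExtension.

Theorem corollary4p4 (R : realType) (eta : R) (eta1 : 1 < eta) :
  [/\ forall (p : nat) (p_prime : prime p) (K : valuedField R),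
        is_Qp_unr_hat eta1 p_prime K ->
        isometric_to_urysohn (R_int eta) (eta_space eta1 K),
      forall (p : nat) (p_prime : prime p) (K : valuedField R),
        is_Cp eta1 p_prime K ->
        isometric_to_urysohn (R_rat eta) (eta_space eta1 K),
      forall k : fieldType, ([set: k] #= [set: nat])%card ->
        isometric_to_urysohn (R_int eta) (eta_space eta1 (laurent_tadic R k))
    & forall k : fieldType, ([set: k] #= [set: nat])%card ->
      forall (L : valuedField R) (j : {rmorphism laurent_tadic R k -> L}),
        is_algebraic_closure j -> extends_val j ->
      forall (K : valuedField R) (c : {rmorphism L -> K}),
        is_completion eta1 c ->
        isometric_to_urysohn (R_rat eta) (eta_space eta1 K)].
Proof.
split=> [p p_prime K|p p_prime K|k kN|k kN L j jac jv K c cK].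
- move=> [U [c [[Qp [L [j [u [jP uv uE]]]]] cK]]].
  apply: (completion_urysohn cK); first by left.
    exact (urysohn_field_unr jP uv uE).
  (* The unramified extension inherits separability from the algebraic closure that contains it. *)
  exact: separable_isometric_sub (isometric_extends uv) (separable_Qp_bar jP).
- move=> [Qp [L [j [c [jP cK]]]]].
  apply: (completion_urysohn cK); first by left.
    exact (urysohn_field_Qp_bar jP).
  exact: separable_Qp_bar jP.
(* Laurent series are already complete, so the criterion applies directly. *)
- apply: urysohn_field_space; first exact: urysohn_field_laurent.
    exact: separable_laurent.
  exact: complete_laurent.
- have [t tN] := laurent_uniformizer eta1 k.
  apply: (completion_urysohn cK); first by left.
    exact (urysohn_field_closure eta1 jac jv (@laurent_value R eta k) tN).
  exact: separable_closure jac jv (separable_laurent eta1 kN).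
Qed.
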